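(* Let $S$ be a countable discrete semigroup with identity. The following conditions are equivalent: (i) $S$ is Liouville, that is, there exists a probability measure $\pi$ on $S$ such that every bounded $\pi$-harmonic function is constant; (ii) $S$ is Reiter, that is, there exists a sequence $(\theta_n)_n$ of probability measures on $S$ such that $\lim_{n\to\infty}\|\theta_n-s\theta_n\|=0$ for all $s\in S$; (iii) $S$ is amenable.
   Context: For $s\in S$ and a probability measure $\theta$ on $S$, $s\theta$ is the pushforward of $\theta$ under $t\mapsto st$; $\|\cdot\|$ is the total variation ($\ell^1$) norm. A function $f:S\to\mathbb C$ is $\pi$-harmonic if $f(x)=\sum_{y\in S}f(xy)\pi(y)$ for all $x\in S$. $S$ is amenable (left amenable) if there is a positive linear functional $\varphi:\ell^\infty(S)\to\mathbb C$ of norm one such that $\varphi(\delta_a*f)=\varphi(f)$ for all $a\in S$ and $f\in\ell^\infty(S)$, where $(\delta_a*f)(x)=f(ax)$. *)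

(* Defs.v *)
From HB Require Import structures.
From mathcomp Require Import all_boot all_order all_algebra finmap.
From mathcomp Require Import complex.
From mathcomp Require Import all_classical all_reals all_analysis.

Set Implicit Arguments.
Unset Strict Implicit.
Unset Printing Implicit Defensive.

Import Order.TTheory GRing.Theory Num.Theory numFieldNormedType.Exports.

Local Open Scope classical_set_scope.
Local Open Scope ring_scope.
Local Open Scope complex_scope.

(** A monoid seen as a discrete measurable space: every subset is measurable.
    The alias makes [probability (discrete S) R] the type of probability
    measures on [S], whatever other structures [S] may carry. *)
Definition discrete (S : monoidType) : Type := S.

HB.instance Definition _ (S : monoidType) := Monoid.on (discrete S).
HB.instance Definition _ (S : monoidType) :=
  isPointed.Build (discrete S) (1%g : S).
HB.instance Definition _ (S : monoidType) :=
  @isMeasurable.Build default_measure_display (discrete S)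
    discrete_measurable discrete_measurable0
    discrete_measurableC discrete_measurableU.

Definition fset_filter (I : choiceType) : set_system {fset I} :=
  filter_from [set: {fset I}] (fun A => [set B | A `<=` B]%fset).

Arguments fset_filter : clear implicits.

#[global] Instance fset_filter_proper (I : choiceType) :
  ProperFilter (fset_filter I).
Proof.
apply: filter_from_proper => [|A _]; last by exists A => /=.
apply: filter_from_filter; first by exists fset0.
move=> A B _ _; exists (A `|` B)%fset => // C /= ABC.
by split; apply: fsubset_trans ABC; rewrite ?fsubsetUl ?fsubsetUr.
Qed.

(** Unordered summation: [l] is the limit of the finite partial sums of [g],
    along finite subsets of the index type directed by inclusion. *)
Definition has_sum (R : realType) (I : choiceType) (g : I -> R[i]) (l : R[i]) :=
  (fun A : {fset I} => \sum_(i <- A) g i : R[i]^o) @ fset_filter I --> (l : R[i]^o).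

Section Semigroup.
Variables (R : realType) (S : monoidType).
Implicit Types (pi theta : probability (discrete S) R).

Definition harmonic pi (f : S -> R[i]^o) :=
  forall x : S,
    has_sum (fun y : S => f (x * y)%g * (fine (pi [set y]))%:C) (f x).

Definition liouville :=
  exists pi, forall f : S -> R[i]^o, bounded_fun f -> harmonic pi f ->
    exists c : R[i], forall x, f x = c.

Definition left_translate (s : S) theta : set (discrete S) -> \bar R :=
  pushforward theta (fun t : discrete S => (s * t)%g : discrete S).

Definition l1_distance (mu nu : set (discrete S) -> \bar R) : \bar R :=
  (\esum_(x in [set: discrete S]) `|mu [set x] - nu [set x]|)%E.

Definition reiter :=
  exists theta : nat -> probability (discrete S) R,
    forall s : S,
      (fun n => l1_distance (theta n) (left_translate s (theta n))) @ \oo --> 0%E.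

Definition bounded_pred : {pred S -> R[i]^o} :=
  mem [set f : S -> R[i]^o | [bounded f x | x in setT]].

Lemma bounded_predP (f : S -> R[i]^o) :
  reflect (exists M : R[i], forall x, `|f x| <= M) (f \in bounded_pred).
Proof.
apply: (iffP idP) => [|[M fM]]; rewrite inE /=.
  move=> [M [Mr fM]]; exists (M + 1) => x.
  by apply: (fM (M + 1)) => //; rewrite ltrDl.
exists M; split.
  by apply: ger0_real; apply: le_trans (fM 1%g).
by move=> N MN x _; exact: le_trans (fM x) (ltW MN).
Qed.

Lemma bounded_submod_closed : submod_closed bounded_pred.
Proof.
split=> [|a f g /bounded_predP[M fM] /bounded_predP[N gN]]; apply/bounded_predP.
  by exists 0 => x; rewrite normr0.
exists (`|a| * M + N) => x; apply: le_trans (ler_normD _ _) _.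
by rewrite lerD // normrM ler_wpM2l.
Qed.

HB.instance Definition _ :=
  GRing.isSubmodClosed.Build R[i] (S -> R[i]^o) bounded_pred
    bounded_submod_closed.

(** The complex vector space of all bounded functions on [S]. *)
Record linf := Linf {
  linf_fun :> S -> R[i]^o;
  linfP : linf_fun \in bounded_pred
}.

HB.instance Definition _ := [isSub for linf_fun].
HB.instance Definition _ := [Choice of linf by <:].
HB.instance Definition _ := [SubChoice_isSubLmodule of linf by <:].

Definition linf_norm (f : linf) : \bar R :=
  ereal_sup [set (Normc.normc (f x))%:E | x in [set: S]].

Definition functional_norm (phi : linf -> R[i]) : \bar R :=
  ereal_sup [set (Normc.normc (phi f))%:E | f in [set f | (linf_norm f <= 1)%E]].

Lemma delta_conv_subproof (a : S) (f : linf) :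
  (fun x : S => f (a * x)%g) \in bounded_pred.
Proof.
have /bounded_predP[M fM] := linfP f.
by apply/bounded_predP; exists M => x; exact: fM.
Qed.

(** [delta_a * f], with the convention [(delta_a * f) x = f (a x)]. *)
Definition delta_conv (a : S) (f : linf) : linf :=
  Linf (delta_conv_subproof a f).

(** In [R[i]], [0 <= z] means that [z] is a nonnegative real number. *)
Definition amenable :=
  exists phi : {scalar linf},
    [/\ forall f : linf, (forall x, 0 <= (f x : R[i])) -> 0 <= (phi f : R[i]),
        functional_norm phi = 1%E
      & forall (a : S) (f : linf), phi (delta_conv a f) = phi f].

End Semigroup.

Arguments liouville : clear implicits.
Arguments reiter : clear implicits.
Arguments amenable : clear implicits.

(* Main.v *)
Require Import Defs.
From HB Require Import structures.
From mathcomp Require Import all_boot all_order all_algebra finmap.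
From mathcomp Require Import complex lra.
From mathcomp Require Import all_classical all_reals all_analysis.

(** The three conditions are compared through a fourth one, [finite_reiter]: for
    every finite set of elements [s] and every [e > 0] there is a finitely
    supported probability measure [theta] whose distance to every [s theta] is
    at most [e], the distance being tested on functions bounded by [1]. The
    equivalence with the Reiter condition is a matter of truncation
    ([reiter_finite_reiter]) and of enumeration of [S] ([finite_reiter_reiter]).

    Liouville implies amenable. Hahn--Banach yields a mean [m] on the bounded
    functions that vanishes on the functions [g - Q g], where
    [Q g z = \sum_y pi(y) g (y z)]: such functions have a nonnegative supremum,
    since [g - Q g <= - e] would give [g <= sup g - e]. For a bounded function
    [g], the function [x |-> m (z |-> g (x z))] is then bounded and harmonic,
    hence constant, and this says that [m] is invariant
    ([liouville_invariant_mean]).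

    Amenable implies [finite_reiter]. If no [theta] works, Hahn--Banach, used as
    a minimax theorem, reverses the quantifiers: one family of test functions
    [f_s] satisfies [\sum_s (f_s t - f_s (s t)) >= e] for all [t] at once. An
    invariant mean of the left side is [0], a contradiction
    ([invariant_mean_minimax]). Both applications of Hahn--Banach go through
    [exists_mean]: a convex cone of bounded functions with nonnegative suprema
    is nonnegative under some mean. The minimax theorem applies it to functions
    on the set of all families of test functions.

    [finite_reiter] implies Liouville, by a construction of Kaimanovich and
    Vershik. Let [pi = \sum_k 2^-(k+1) theta_k], where [theta_k] is almost
    invariant under all products of many elements of the supports of the
    previous measures. A walk with law [pi] starting in a finite set hardly
    leaves the products of elements met before stage [i] until an increment from
    a later stage makes it forget its starting point. So a bounded harmonic
    function has a small oscillation on every finite set ([harmonic_osc_step]),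
    and it is constant. *)

Set Implicit Arguments.
Unset Strict Implicit.
Unset Printing Implicit Defensive.

Import Order.TTheory GRing.Theory Num.Theory numFieldNormedType.Exports.

Local Open Scope classical_set_scope.
Local Open Scope ring_scope.
Local Open Scope complex_scope.

Local Notation Re := (@complex.Re _).
Local Notation Im := (@complex.Im _).

(** * The Hahn--Banach and Mazur--Orlicz theorems *)

Section HahnBanach.
Variables (R : realType) (V : lmodType R).
Implicit Types (p q : V -> R) (C : set (V * R)) (u v : V).

Definition sublinear p :=
  (forall u v, p (u + v) <= p u + p v) /\
  (forall a u, 0 <= a -> p (a *: u) = a * p u).

(** Encodes a family of lower bounds [r <= L u] to be imposed on a linear
    functional [L], closed under the consequences linearity draws from it. *)
Definition convex_cone C :=
  [/\ C (0, 0),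
      forall u r v s, C (u, r) -> C (v, s) -> C (u + v, r + s)
    & forall a u r, 0 <= a -> C (u, r) -> C (a *: u, a * r)].

Lemma le_inf_add (A B E : set R) : A !=set0 -> B !=set0 -> has_lbound E ->
  (forall a b, A a -> B b -> exists2 e, E e & e <= a + b) ->
  inf E <= inf A + inf B.
Proof.
move=> A0 B0 lE ABE; rewrite -lerBlDr; apply: lb_le_inf => // a Aa.
rewrite lerBlDr -lerBlDl; apply: lb_le_inf => // b Bb.
rewrite lerBlDl; have [e Ee eab] := ABE _ _ Aa Bb.
by apply: le_trans eab; exact: ge_inf.
Qed.

Lemma sublinear0 p : sublinear p -> p 0 = 0.
Proof. by case=> _ /(_ 0 0 (lexx 0)); rewrite scale0r mul0r. Qed.

Lemma sublinearN p u : sublinear p -> - p (- u) <= p u.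
Proof.
move=> sp; have := sp.1 u (- u); rewrite subrr sublinear0// => ?.
by rewrite lerNl -subr_ge0 opprK addrC.
Qed.

(** Positive homogeneity only needs one inequality, at positive scalars: the
    other one is the same inequality for the inverse scalar. *)
Lemma sublinear_intro p : p 0 = 0 ->
  (forall u v, p (u + v) <= p u + p v) ->
  (forall a u, 0 < a -> p (a *: u) <= a * p u) -> sublinear p.
Proof.
move=> p0 pD pZ; split=> // a u; rewrite le_eqVlt => /predU1P[<-|a0].
  by rewrite scale0r mul0r.
apply/le_anti; rewrite pZ//= -ler_pdivlMl//.
have := pZ a^-1 (a *: u); rewrite invr_gt0 => /(_ a0).
by rewrite scalerA mulVf ?gt_eqF// scale1r.
Qed.

(** The largest sublinear functional below [p] that takes, at [- v], a value
    at most [- r] whenever [(v, r)] lies in the cone. *)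
Definition cone_inf p C u := inf [set p (u + c.1) - c.2 | c in C].

Section ConeInf.
Variables (p : V -> R) (C : set (V * R)).
Hypotheses (sp : sublinear p) (coneC : convex_cone C).
Hypothesis C_le : forall u r, C (u, r) -> r <= p u.

Let cone_inf_ge u r : C r -> - p (- u) <= p (u + r.1) - r.2.
Proof.
case: r => v r /= Cvr; rewrite lerBrDr.
have := sp.1 (u + v) (- u); rewrite addrAC subrr add0r => h.
by have := C_le Cvr; lra.
Qed.

Let cone_inf_lb u : has_lbound [set p (u + c.1) - c.2 | c in C].
Proof. by exists (- p (- u)) => _ [c Cc <-]; exact: cone_inf_ge. Qed.

Let cone_inf_n0 u : [set p (u + c.1) - c.2 | c in C] !=set0.
Proof. by have [C0 _ _] := coneC; exists (p (u + 0) - 0); exists (0, 0). Qed.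

Lemma cone_inf_le v r u : C (v, r) -> cone_inf p C u <= p (u + v) - r.
Proof. by move=> Cvr; apply: ge_inf => //; exists (v, r). Qed.

Lemma cone_inf_le_self u : cone_inf p C u <= p u.
Proof.
have [C0 _ _] := coneC; apply: le_trans (cone_inf_le u C0) _.
by rewrite addr0 subr0.
Qed.

Lemma cone_inf_sublinear : sublinear (cone_inf p C).
Proof.
have [C0 CD CZ] := coneC; apply: sublinear_intro.
- apply/le_anti/andP; split.
    by apply: le_trans (cone_inf_le_self 0) _; rewrite sublinear0.
  apply: lb_le_inf => // _ [[v r] Cvr <-].
  by rewrite add0r subr_ge0; exact: C_le.
- move=> u v; apply: le_inf_add => // _ _ [[u' r] Cu <-] [[v' s] Cv <-].
  exists (p (u + v + (u' + v')) - (r + s)).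
    by exists (u' + v', r + s) => //; exact: CD.
  rewrite addrACA; have := sp.1 (u + u') (v + v'); rewrite /=; lra.
- move=> a u a0; rewrite -ler_pdivrMl//; apply: lb_le_inf => //.
  move=> _ [[v r] Cv <-]; rewrite ler_pdivrMl//.
  rewrite mulrBr -(sp.2 _ _ (ltW a0)) scalerDr/=.
  exact: cone_inf_le _ (CZ _ _ _ (ltW a0) Cv).
Qed.

End ConeInf.

(** Zorn's lemma applies because the pointwise infimum of a chain of sublinear
    functionals below [p] is again one. *)
Lemma minimal_sublinear p : sublinear p ->
  exists q, [/\ sublinear q, forall u, q u <= p u
    & forall q', sublinear q' -> (forall u, q' u <= q u) -> q' = q].
Proof.
move=> sp.
pose T := {q : V -> R | sublinear q /\ forall u, q u <= p u}.
pose le (q1 q2 : T) := `[< forall u, sval q2 u <= sval q1 u >].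
have [||||q qmin] := @Zorn T le.
- by move=> q; apply/asboolP.
- move=> q1 q2 q3 /asboolP h1 /asboolP h2.
  by apply/asboolP => u; exact: le_trans (h2 u) (h1 u).
- move=> [q1 P1] [q2 P2] /asboolP/= h1 /asboolP/= h2.
  have q12 : q1 = q2 by apply/funext => u; apply/le_anti; rewrite h1 h2.
  by rewrite -q12 in P2 *; congr exist; exact: Prop_irrelevance.
- move=> A Atot.
  have [[q0 Aq0]|A0] := pselect (A !=set0); last first.
    exists (exist _ p (conj sp (fun u => lexx (p u)))) => q Aq.
    by exfalso; apply: A0; exists q.
  pose vals u := [set sval q u | q in A].
  have vals_lb u : has_lbound (vals u).
    exists (- p (- u)) => _ [q Aq <-]; have [sq qp] := svalP q.
    by apply: le_trans (sublinearN _ sq); rewrite lerN2.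
  have vals_n0 u : vals u !=set0 by exists (sval q0 u); exists q0.
  have inf_le (q : T) u : A q -> inf (vals u) <= sval q u.
    by move=> Aq; apply: ge_inf => //; exists q.
  have sinf : sublinear (fun u => inf (vals u)).
    apply: sublinear_intro.
    + rewrite (_ : vals 0 = [set 0]) ?inf1//; apply/seteqP; split.
        by move=> _ [q Aq <-]; rewrite /= sublinear0//; exact: (svalP q).1.
      by move=> _ ->; exists q0 => //; exact: sublinear0 (proj1 (svalP q0)).
    + move=> u v; apply: le_inf_add => // _ _ [q1 A1 <-] [q2 A2 <-].
      have [/asboolP h|/asboolP h] := Atot _ _ A1 A2.
        exists (sval q2 (u + v)); first by exists q2.
        by apply: le_trans ((svalP q2).1.1 u v) _; rewrite lerD2r.
      exists (sval q1 (u + v)); first by exists q1.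
      by apply: le_trans ((svalP q1).1.1 u v) _; rewrite lerD2l.
    + move=> a u a0; rewrite -ler_pdivrMl//; apply: lb_le_inf => //.
      move=> _ [q Aq <-]; rewrite ler_pdivrMl// -((svalP q).1.2 _ _ (ltW a0)).
      exact: inf_le.
  have infp u : inf (vals u) <= p u.
    exact: le_trans (inf_le _ _ Aq0) ((svalP q0).2 u).
  exists (exist _ (fun u => inf (vals u)) (conj sinf infp)) => q Aq.
  by apply/asboolP => u; exact: inf_le.
exists (sval q); have [sq qp] := svalP q; split=> // q' sq' q'q.
have q'p u : q' u <= p u by exact: le_trans (q'q u) (qp u).
by have <- := qmin (exist _ q' (conj sq' q'p)) (asboolT q'q).
Qed.

(** A minimal sublinear functional [q] is linear: pushing it down along the
    ray through [y], with slope [q y], yields a sublinear functional below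
    [q], hence [q] itself, which gives [q x <= q (x + y) - q y]. *)
Lemma hahn_banach p : sublinear p ->
  exists L : V -> R, scalar L /\ forall u, L u <= p u.
Proof.
move=> /minimal_sublinear[q [sq qp qmin]]; exists q; split=> //.
have qD x y : q (x + y) = q x + q y.
  apply/le_anti; rewrite sq.1/= -lerBrDr.
  pose C := [set c : V * R | exists2 t, 0 <= t & c = (t *: y, t * q y)].
  have coneC : convex_cone C.
    split.
    - by exists 0 => //; rewrite scale0r mul0r.
    - move=> _ _ _ _ [t t0 [-> ->]] [s s0 [-> ->]].
      by exists (t + s); rewrite ?addr_ge0// scalerDl mulrDl.
    - move=> a _ _ a0 [t t0 [-> ->]].
      by exists (a * t); rewrite ?mulr_ge0// scalerA mulrA.
  have Cle u r : C (u, r) -> r <= q u.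
    by move=> [t t0 [-> ->]]; rewrite sq.2.
  rewrite -{1}(qmin _ (cone_inf_sublinear sq coneC Cle)); last first.
    by move=> u; exact: cone_inf_le_self.
  by apply: (cone_inf_le sq Cle); exists 1; rewrite ?scale1r ?mul1r.
have q0 := sublinear0 sq.
have qN u : q (- u) = - q u.
  by apply/eqP; rewrite -addr_eq0 -qD addNr q0.
move=> a u v; rewrite qD; congr (_ + _).
have [a0|a0] := leP 0 a; first exact: sq.2.
rewrite -[in LHS](opprK a) scaleNr qN sq.2 ?oppr_ge0 ?ltW//.
by rewrite mulNr opprK.
Qed.

(** Hahn--Banach applied to [cone_inf p C], which both lies below [p] and
    forces the lower bounds prescribed by [C]. *)
Lemma mazur_orlicz p C : sublinear p -> convex_cone C ->
  (forall u r, C (u, r) -> r <= p u) ->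
  exists L : V -> R, [/\ scalar L, forall u, L u <= p u
    & forall u r, C (u, r) -> r <= L u].
Proof.
move=> sp coneC Cle.
have [L [linL Lp]] := hahn_banach (cone_inf_sublinear sp coneC Cle).
exists L; split=> // [u|u r Cur].
  exact: le_trans (Lp u) (cone_inf_le_self sp coneC Cle u).
have L0 : L 0 = 0.
  by have := linL 1 0 0; rewrite scaler0 addr0 mul1r; lra.
have LN : L (- u) = - L u.
  by have := linL (-1) u 0; rewrite !addr0 L0 scaleN1r mulN1r addr0.
have := le_trans (Lp (- u)) (cone_inf_le sp Cle (- u) Cur).
by rewrite addNr (sublinear0 sp) sub0r LN lerN2.
Qed.

End HahnBanach.

(** * Means on bounded functions *)

Section Means.
Variables (R : realType) (X : Type).
Implicit Types (u v : X -> R) (m : (X -> R) -> R).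

Definition bounded_real u := exists M, forall x, `|u x| <= M.

(** Means are taken as maps on all functions, so that they apply without
    proofs of boundedness; their values at unbounded functions are arbitrary. *)
Definition is_mean m :=
  (forall a u v, bounded_real u -> bounded_real v ->
     m (fun x => a * u x + v x) = a * m u + m v) /\
  (forall u c, bounded_real u -> (forall x, u x <= c) -> m u <= c).

Definition bounded_real_pred : {pred X -> R^o} :=
  mem [set u : X -> R^o | bounded_real u].

Lemma bounded_real_cst c : bounded_real (fun=> c).
Proof. by exists `|c|. Qed.

Lemma bounded_real_lin a u v : bounded_real u -> bounded_real v ->
  bounded_real (fun x => a * u x + v x).
Proof.
move=> [M uM] [N vN]; exists (`|a| * M + N) => x.
apply: le_trans (ler_normD _ _) _.
by rewrite lerD// normrM ler_wpM2l.
Qed.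

Lemma bounded_realD u v : bounded_real u -> bounded_real v ->
  bounded_real (fun x => u x + v x).
Proof.
move=> bu bv; have [M uM] := bounded_real_lin 1 bu bv.
by exists M => x; have := uM x; rewrite mul1r.
Qed.

Lemma bounded_realZ a u : bounded_real u -> bounded_real (fun x => a * u x).
Proof.
move=> bu; have [M uM] := bounded_real_lin a bu (bounded_real_cst 0).
by exists M => x; have := uM x; rewrite addr0.
Qed.

Lemma bounded_realB u v : bounded_real u -> bounded_real v ->
  bounded_real (fun x => u x - v x).
Proof.
move=> bu bv; apply: bounded_realD => //.
by have [M vM] := bv; exists M => x; rewrite normrN; exact: vM.
Qed.

Lemma bounded_real_sum (I : Type) (r : seq I) (f : I -> X -> R) :
  (forall i, bounded_real (f i)) -> bounded_real (fun x => \sum_(i <- r) f i x).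
Proof.
move=> bf; elim: r => [|i r IH].
  by exists 0 => x; rewrite big_nil normr0.
have [M uM] := bounded_realD (bf i) IH.
by exists M => x; rewrite big_cons; exact: uM.
Qed.

Lemma bounded_real_submod_closed : submod_closed bounded_real_pred.
Proof.
split=> [|a u v]; first by rewrite inE; exact: bounded_real_cst.
by rewrite !inE; exact: bounded_real_lin.
Qed.

HB.instance Definition _ :=
  GRing.isSubmodClosed.Build R (X -> R^o) bounded_real_pred
    bounded_real_submod_closed.

(** Hahn--Banach needs a vector space on which [sup] is finite. *)
Record bfun := Bfun {
  bfun_fun :> X -> R^o;
  bfunP : bfun_fun \in bounded_real_pred
}.

HB.instance Definition _ := [isSub for bfun_fun].
HB.instance Definition _ := [Choice of bfun by <:].
HB.instance Definition _ := [SubChoice_isSubLmodule of bfun by <:].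

Lemma has_ubound_bfun (u : bfun) : has_ubound (range u).
Proof.
have := bfunP u; rewrite inE => -[M uM].
by exists M => _ [x _ <-]; exact: le_trans (ler_norm _) (uM x).
Qed.

Hypothesis X_inhabited : inhabited X.

Lemma range_n0 (u : bfun) : range u !=set0.
Proof. by case: X_inhabited => x; exists (u x); exists x. Qed.

Lemma sup_sublinear : sublinear (fun w : bfun => sup (range w)).
Proof.
apply: sublinear_intro => [|u v|a u a0].
- rewrite (_ : range _ = [set 0]) ?sup1//; apply/seteqP; split.
    by move=> _ [x _ <-].
  by move=> _ ->; case: X_inhabited => x; exists x.
- apply: ge_sup (range_n0 _) _ => _ [x _ <-].
  by apply: lerD; apply: ub_le_sup (has_ubound_bfun _) _ _; exists x.
- apply: ge_sup (range_n0 _) _ => _ [x _ <-].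
  have ux : u x <= sup (range u).
    by apply: ub_le_sup (has_ubound_bfun _) _ _; exists x.
  exact: ler_wpM2l (ltW a0) _ _ ux.
Qed.

(** The Mazur--Orlicz theorem for the sublinear functional [sup]: below it, the
    linear functionals are exactly the finitely additive averages. *)
Lemma exists_mean (C : set (X -> R)) :
  (forall u, C u -> bounded_real u) ->
  C (fun=> 0) ->
  (forall u v, C u -> C v -> C (fun x => u x + v x)) ->
  (forall a u, 0 <= a -> C u -> C (fun x => a * u x)) ->
  (forall u, C u -> forall e, 0 < e -> exists x, - e < u x) ->
  exists m, is_mean m /\ forall u, C u -> 0 <= m u.
Proof.
move=> Cb C0 CD CZ Csup.
have [|||L [linL Lsup LC]] := @mazur_orlicz R bfun (fun w : bfun => sup (range w))
  [set c : bfun * R | C (bfun_fun c.1) /\ c.2 = 0].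
- exact: sup_sublinear.
- split=> //=.
    by move=> u r v s [Cu ->] [Cv ->]; rewrite addr0; split=> //; exact: CD.
  by move=> a u r a0 [Cu ->]; rewrite mulr0; split=> //; exact: CZ.
- move=> u _ [/= Cu ->]; apply/ler_addgt0Pr => e e0.
  have [x ex] := Csup _ Cu e e0.
  rewrite -lerBlDr sub0r; apply: le_trans (ltW ex) _.
  by apply: ub_le_sup (has_ubound_bfun _) _ _; exists x.
(* Unbounded functions are sent to the default value [0]. *)
pose m (u : X -> R) := L (insubd (0 : bfun) u).
have mE u (bu : bounded_real u) : m u = L (Bfun (mem_set bu)).
  by congr L; apply: val_inj; rewrite insubdK//; exact: mem_set.
exists m; split; first split.
- move=> a u v bu bv; rewrite (mE _ bu) (mE _ bv) -linL.
  by rewrite (mE _ (bounded_real_lin a bu bv)); congr L; exact: val_inj.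
- move=> u c bu uc; rewrite (mE _ bu); apply: le_trans (Lsup _) _.
  by apply: ge_sup (range_n0 _) _ => _ [x _ <-]; exact: uc.
- by move=> u Cu; rewrite (mE _ (Cb _ Cu)); exact: LC.
Qed.

Section MeanTheory.
Variable m : (X -> R) -> R.
Hypothesis mean_m : is_mean m.

Lemma mean0 : m (fun=> 0) = 0.
Proof.
have b0 := bounded_real_cst 0; have := mean_m.1 1 _ _ b0 b0.
by rewrite mulr0 addr0 mul1r; lra.
Qed.

Lemma meanZ a u : bounded_real u -> m (fun x => a * u x) = a * m u.
Proof.
move=> bu; have := mean_m.1 a _ _ bu (bounded_real_cst 0).
rewrite mean0 addr0 => <-; congr m; apply/funext => x.
by rewrite addr0.
Qed.

Lemma meanD u v : bounded_real u -> bounded_real v ->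
  m (fun x => u x + v x) = m u + m v.
Proof.
move=> bu bv; have := mean_m.1 1 _ _ bu bv.
rewrite mul1r => <-; congr m; apply/funext => x.
by rewrite mul1r.
Qed.

Lemma meanB u v : bounded_real u -> bounded_real v ->
  m (fun x => u x - v x) = m u - m v.
Proof.
move=> bu bv; have := mean_m.1 (-1) _ _ bv bu.
rewrite mulN1r addrC => <-; congr m; apply/funext => x.
by rewrite mulN1r addrC.
Qed.

Lemma mean_sum (I : Type) (r : seq I) (f : I -> X -> R) :
  (forall i, bounded_real (f i)) ->
  m (fun x => \sum_(i <- r) f i x) = \sum_(i <- r) m (f i).
Proof.
move=> bf; elim: r => [|i r IH].
  rewrite big_nil -[RHS]mean0; congr m; apply/funext => x.
  by rewrite big_nil.
rewrite big_cons -IH -meanD//; last exact: bounded_real_sum.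
by congr m; apply/funext => x; rewrite big_cons.
Qed.

Lemma mean_le u c : bounded_real u -> (forall x, u x <= c) -> m u <= c.
Proof. exact: mean_m.2. Qed.

Lemma mean_ge u c : bounded_real u -> (forall x, c <= u x) -> c <= m u.
Proof.
move=> bu cu; rewrite -lerN2 -mulN1r -(meanZ _ bu).
apply: mean_le => [|x]; first exact: bounded_realZ.
by rewrite mulN1r lerN2.
Qed.

Lemma mean_cst c : m (fun=> c) = c.
Proof.
have bc := bounded_real_cst c; apply/le_anti.
by rewrite mean_le//= mean_ge.
Qed.

Lemma mean_norm u c : (forall x, `|u x| <= c) -> `|m u| <= c.
Proof.
move=> uc; have bu : bounded_real u by exists c.
rewrite ler_norml mean_ge ?mean_le// => x; have := uc x;
by rewrite ler_norml => /andP[].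
Qed.

End MeanTheory.

End Means.

(** * Weights of a probability measure *)

Lemma sum_fset_split (R : nmodType) (I : choiceType) (A B : {fset I})
  (g : I -> R) : (A `<=` B)%fset ->
  \sum_(i <- B) g i = \sum_(i <- A) g i + \sum_(i <- (B `\` A)%fset) g i.
Proof.
move=> AB; rewrite -big_cat; apply: perm_big; apply: uniq_perm => //.
  rewrite cat_uniq !fset_uniq andbT/=; apply/hasPn => i.
  by rewrite inE => /andP[].
move=> i; rewrite mem_cat inE; case: (boolP (i \in A)) => //= iA.
by rewrite (fsubsetP AB).
Qed.

Section Weights.
Variables (R : realType) (S : monoidType).
Implicit Types (pi : probability (discrete S) R) (B : {fset S}).

Definition weight pi (y : S) : R := fine (pi [set y]).

Lemma weight_ge0 pi y : 0 <= weight pi y.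
Proof. by rewrite fine_ge0. Qed.

Lemma probability_fineK pi (A : set (discrete S)) : (fine (pi A))%:E = pi A.
Proof. by rewrite fineK// fin_num_measure. Qed.

Lemma sum_weight pi B : (\sum_(y <- B) weight pi y)%:E = pi [set` B].
Proof.
rewrite -sumEFin; under eq_bigr do rewrite probability_fineK.
rewrite -(@measure_fbigsetU _ _ _ pi S B (fun y => [set y]))//.
  congr (pi _); rewrite -bigcup_fset; apply/seteqP; split=> x /=.
    by move=> [y yB ->].
  by move=> xB; exists x.
by move=> x y _ _ [z [/= -> ->]].
Qed.

Lemma sum_weight_le1 pi B : \sum_(y <- B) weight pi y <= 1.
Proof. by rewrite -lee_fin sum_weight probability_le1. Qed.

Lemma near_fset_ge B : \forall C \near fset_filter S, (B `<=` C)%fset.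
Proof. by exists B. Qed.

(** An injection of [S] into the naturals exhausts [S] by an increasing
    sequence of finite sets, along which the measure is continuous. *)
Lemma near_sum_weight pi : countable [set: S] -> forall e, 0 < e ->
  \forall B \near fset_filter S, 1 - e < \sum_(y <- (B : {fset S})) weight pi y.
Proof.
move=> /countable_injP[f finj] e e0.
pose F n := [set x : discrete S | (f x < n)%N].
have Ffin n : finite_set (F n).
  apply: (@finite_preimage _ _ `I_n f) (finite_II n) => x y _ _.
  by apply: finj; rewrite inE.
have FT : \bigcup_n F n = [set: discrete S].
  by apply/seteqP; split=> // x _; exists (f x).+1 => //=; rewrite /F /=.
have Fmono : {homo F : n m / (n <= m)%N >-> (n <= m)%O}.
  by move=> n m nm; apply/subsetPset => x /= /leq_trans; apply.
have piT : pi [set: discrete S] = 1%E := probability_setT pi.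
have piF : (pi \o F) @ \oo --> 1%E.
  by rewrite -piT -FT; exact: nondecreasing_cvg_mu.
have nbh1 : nbhs (1%E : \bar R) [set x | ((1 - e)%:E < x)%E].
  apply: open_nbhs_nbhs; split; first exact: open_ereal_gt_ereal.
  by rewrite /= lte_fin ltrBlDr ltrDl.
have [n _ nF] := piF _ nbh1.
have := nF n (leqnn n); rewrite /= -(fset_setK (Ffin n)) -sum_weight lte_fin.
move=> h; exists (fset_set (F n)) => // B /= FB.
apply: lt_le_trans h _; rewrite (sum_fset_split _ FB) lerDl.
by apply: sumr_ge0 => y _; exact: weight_ge0.
Qed.

End Weights.

(** * Real and complex harmonic functions *)

Section Sums.
Variables (R : realType) (I : choiceType).

Definition real_sum (g : I -> R) (l : R) := forall e, 0 < e ->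
  \forall B \near fset_filter I, `|l - \sum_(i <- (B : {fset I})) g i| < e.

Lemma normc_ge_Im (z : R[i]) : `|Im z|%:C <= `|z|.
Proof.
have -> : Im z = Re (z * - 'i) by case: z => a b /=; simpc.
apply: le_trans (normc_ge_Re _) _; rewrite normrM normrN.
rewrite (_ : `|'i| = 1) ?mulr1//.
by rewrite normc_def /= expr0n/= expr1n add0r sqrtr1.
Qed.

Lemma normr_complex (x : R) : `|x%:C| = `|x|%:C :> R[i].
Proof. by rewrite normc_def/= expr0n/= addr0 sqrtr_sqr. Qed.

Lemma has_sumP (g : I -> R[i]) (l : R[i]) : has_sum g l <->
  (forall e : R[i], 0 < e ->
  \forall B \near fset_filter I, `|l - \sum_(i <- (B : {fset I})) g i| < e).
Proof. by rewrite /has_sum cvgrPdist_lt. Qed.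

Lemma has_sum_real_complex (g : I -> R) (l : R) :
  real_sum g l -> has_sum (fun i => (g i)%:C) l%:C.
Proof.
move=> gl; apply/has_sumP => e e0.
have [e' e'E] : exists e', e = e'%:C.
  by exists (Re e); rewrite RRe_real// ger0_real// ltW.
move: e0; rewrite e'E ltcR => /gl; apply: filterS => B.
by rewrite -rmorph_sum -rmorphB normr_complex ltcR.
Qed.

Lemma has_sum_Re (g : I -> R[i]) (l : R[i]) :
  has_sum g l -> real_sum (fun i => Re (g i)) (Re l).
Proof.
move=> /has_sumP gl e e0.
have /gl : 0 < e%:C :> R[i] by rewrite ltcR.
apply: filterS => B h; rewrite -ltcR; apply: le_lt_trans h.
apply: le_trans (normc_ge_Re _).
rewrite lecR (raddfB (@complex.Re R : Rcomplex R -> R)).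
by rewrite (raddf_sum (@complex.Re R : Rcomplex R -> R)).
Qed.

Lemma has_sum_Im (g : I -> R[i]) (l : R[i]) :
  has_sum g l -> real_sum (fun i => Im (g i)) (Im l).
Proof.
move=> /has_sumP gl e e0.
have /gl : 0 < e%:C :> R[i] by rewrite ltcR.
apply: filterS => B h; rewrite -ltcR; apply: le_lt_trans h.
apply: le_trans (normc_ge_Im _).
rewrite lecR (raddfB (@complex.Im R : Rcomplex R -> R)).
by rewrite (raddf_sum (@complex.Im R : Rcomplex R -> R)).
Qed.

End Sums.

Section Harmonic.
Variables (R : realType) (S : monoidType).
Implicit Types (pi : probability (discrete S) R) (f : S -> R[i]) (u : S -> R).

Definition real_harmonic pi u :=
  forall x, real_sum (fun y => u (x * y)%g * weight pi y) (u x).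

Lemma harmonic_real pi u :
  real_harmonic pi u -> Defs.harmonic pi (fun x => (u x)%:C).
Proof.
move=> hu x; have := has_sum_real_complex (hu x).
by congr has_sum; apply/funext => y; rewrite rmorphM.
Qed.

Lemma harmonic_Re pi f :
  Defs.harmonic pi f -> real_harmonic pi (fun x => Re (f x)).
Proof.
move=> hf x; have := has_sum_Re (hf x).
by congr real_sum; apply/funext => y; case: (f _) => a b /=; rewrite mulr0 subr0.
Qed.

Lemma harmonic_Im pi f :
  Defs.harmonic pi f -> real_harmonic pi (fun x => Im (f x)).
Proof.
move=> hf x; have := has_sum_Im (hf x).
by congr real_sum; apply/funext => y; case: (f _) => a b /=; rewrite mulr0 add0r.
Qed.

(** Bounds of complex functions may be taken real, since a complex number above
    a norm is real. *)
Lemma bounded_fun_complex (f : S -> R[i]^o) :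
  bounded_fun f <-> exists M : R, forall x, `|f x| <= M%:C.
Proof.
have -> : bounded_fun f <-> f \in bounded_pred (R := R) (S := S).
  by rewrite inE.
split=> [/bounded_predP[M fM]|[M fM]]; last by apply/bounded_predP; exists M%:C.
have M0 : 0 <= M by apply: le_trans (fM 1%g).
by exists (Re M) => x; rewrite RRe_real// ger0_real.
Qed.

Lemma bounded_real_complex (u : S -> R) :
  bounded_fun (fun x => (u x)%:C : R[i]^o) <-> bounded_real u.
Proof.
rewrite bounded_fun_complex; split=> -[M uM]; exists M => x; have := uM x;
by rewrite -lecR normr_complex.
Qed.

Lemma bounded_real_Re (f : S -> R[i]^o) :
  bounded_fun f -> bounded_real (fun x => Re (f x)).
Proof.
move=> /bounded_fun_complex[M fM]; exists M => x; rewrite -lecR.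
exact: le_trans (normc_ge_Re _) (fM x).
Qed.

Lemma bounded_real_Im (f : S -> R[i]^o) :
  bounded_fun f -> bounded_real (fun x => Im (f x)).
Proof.
move=> /bounded_fun_complex[M fM]; exists M => x; rewrite -lecR.
exact: le_trans (normc_ge_Im _) (fM x).
Qed.

(** Harmonicity and boundedness of a complex function are those of its real
    and imaginary parts. *)
Lemma real_liouville pi :
  (forall f : S -> R[i]^o, bounded_fun f -> Defs.harmonic pi f ->
    exists c : R[i], forall x, f x = c) <->
  (forall u : S -> R, bounded_real u -> real_harmonic pi u ->
    forall x, u x = u 1%g).
Proof.
split=> [L u bu hu x|L f bf hf].
  have [//|c uc] := L (fun x => (u x)%:C) _ (harmonic_real hu).
    exact/bounded_real_complex.
  by apply: (@complexI R); rewrite !uc.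
exists (f 1%g) => x; apply/eqP; rewrite eq_complex; apply/andP; split; apply/eqP.
  exact: (L _ (bounded_real_Re bf) (harmonic_Re hf) x).
exact: (L _ (bounded_real_Im bf) (harmonic_Im hf) x).
Qed.

End Harmonic.

(** * From the Liouville property to an invariant mean *)

Definition invariant_mean (R : realType) (S : monoidType)
    (m : (S -> R) -> R) :=
  is_mean m /\
  forall s u, bounded_real u -> m (fun x => u (s * x)%g) = m u.

Section LiouvilleMean.
Variables (R : realType) (S : monoidType).
Variable (pi : probability (discrete S) R).
Hypothesis S_countable : countable [set: S].
Implicit Types (u g h c : S -> R) (B : {fset S}).
Local Notation w := (weight pi).

Lemma bounded_real_comp (X Y : Type) (u : Y -> R) (f : X -> Y) :
  bounded_real u -> bounded_real (fun x => u (f x)).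
Proof. by move=> [M uM]; exists M => x; exact: uM. Qed.

(** The functions [c] that dominate some coboundary [g - Q g], where
    [Q g z = \sum_y pi(y) g (y z)]. The approximation by finite sums, uniform in
    [z], states this without forming the infinite sum. *)
Definition coboundary_le : set (S -> R) := [set c | bounded_real c /\
  exists2 g, bounded_real g & forall e, 0 < e ->
    \forall B \near fset_filter S, forall z,
      g z - \sum_(y <- (B : {fset S})) w y * g (y * z)%g <= c z + e].

(** If [c <= - e] everywhere, then [g <= Q g - e <= sup g - e], which
    contradicts the definition of [sup g]. *)
Lemma coboundary_le_sup c : coboundary_le c ->
  forall e, 0 < e -> exists x, - e < c x.
Proof.
move=> [_ [g [M gM] gc]] e e0; apply: contrapT => /forallNP ce.
have {}ce z : c z <= - e by rewrite leNgt; apply/negP; exact: ce.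
have M0 : 0 <= M by exact: le_trans (gM 1%g).
pose G := sup (range g).
have gG z : g z <= G.
  apply: ub_le_sup; last by exists z.
  by exists M => _ [x _ <-]; exact: le_trans (ler_norm _) (gM x).
have GM : - M <= G.
  by apply: le_trans (gG 1%g); move: (gM 1%g); rewrite ler_norml => /andP[].
have e2 : 0 < e / 2 by rewrite divr_gt0.
have M1 : 0 < M + 1 by rewrite ltr_wpDl.
have eM : 0 < e / 4 / (M + 1) by rewrite !divr_gt0.
have [B [gB wB]] := filter_ex (filterI (gc _ e2) (near_sum_weight pi S_countable eM)).
suff : G <= G - e / 4 by lra.
apply: ge_sup; first by exists (g 1%g); exists 1%g.
move=> _ [z _ <-]; have := gB z; have := ce z.
have : \sum_(y <- B) w y * g (y * z)%g <= (\sum_(y <- B) w y) * G.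
  by rewrite mulr_suml; apply: ler_sum => y _; rewrite ler_wpM2l ?weight_ge0.
have w1 := sum_weight_le1 pi B; rewrite /= in wB.
set W := \sum_(y <- B) w y in w1 wB *.
have : (1 - W) * (M + 1) <= e / 4.
  by rewrite -ler_pdivlMr// lerBlDr -lerBlDl; exact: ltW.
have : 0 <= (1 - W) * (G + M) by rewrite mulr_ge0//; lra.
rewrite !mulrDr !mulrDl; lra.
Qed.

Lemma coboundary_leD c c' : coboundary_le c -> coboundary_le c' ->
  coboundary_le (fun x => c x + c' x).
Proof.
move=> [bc [g bg gc]] [bc' [g' bg' gc']]; split; first exact: bounded_realD.
exists (fun x => g x + g' x); first exact: bounded_realD.
move=> e e0; have e2 : 0 < e / 2 by rewrite divr_gt0.
apply: filterS2 (gc _ e2) (gc' _ e2) => B h h' z.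
under eq_bigr do rewrite mulrDr.
by rewrite big_split/=; have := h z; have := h' z; lra.
Qed.

Lemma coboundary_leZ a c : 0 <= a -> coboundary_le c ->
  coboundary_le (fun x => a * c x).
Proof.
move=> a0 [bc [g bg gc]]; split; first exact: bounded_realZ.
exists (fun x => a * g x); first exact: bounded_realZ.
move=> e e0; have a1 : 0 < a + 1 by rewrite ltr_wpDl.
have ea : 0 < e / (a + 1) by rewrite divr_gt0.
apply: filterS (gc _ ea) => B h z.
under eq_bigr do rewrite mulrCA.
rewrite -mulr_sumr -mulrBr; apply: le_trans (ler_wpM2l a0 (h z)) _.
rewrite mulrDr lerD2l mulrCA ler_piMr ?(ltW e0)//.
by rewrite ler_pdivrMr// mul1r lerDl.
Qed.

(** The terms of [Q g] outside of [B] are paid for by [M] times the mass that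
    [pi] gives to them. *)
Lemma coboundary_le_trunc g M B : (forall x, `|g x| <= M) ->
  coboundary_le (fun z => g z - \sum_(y <- B) w y * g (y * z)%g
                          + M * (1 - \sum_(y <- B) w y)).
Proof.
move=> gM; have bg : bounded_real g by exists M.
have bgy y : bounded_real (fun z => g (y * z)%g) by exact: bounded_real_comp.
split.
  apply: bounded_realD (bounded_real_cst _ _); apply: bounded_realB => //.
  by apply: bounded_real_sum => y; exact: bounded_realZ.
exists g => // e e0; apply: filterS (near_fset_ge B) => C BC z.
rewrite (sum_fset_split _ BC).
have : - \sum_(y <- (C `\` B)%fset) w y * g (y * z)%g <=
    M * \sum_(y <- (C `\` B)%fset) w y.
  rewrite -sumrN mulr_sumr; apply: ler_sum => y _.
  rewrite -mulrN mulrC ler_wpM2r ?weight_ge0//.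
  by apply: le_trans (gM (y * z)%g); rewrite -normrN ler_norm.
have : M * (\sum_(y <- B) w y + \sum_(y <- (C `\` B)%fset) w y) <= M * 1.
  rewrite -sum_fset_split//; apply: ler_wpM2l (sum_weight_le1 pi C).
  exact: le_trans (gM 1%g).
rewrite mulrDr mulrBr; lra.
Qed.

Section Stationary.
Variable m : (S -> R) -> R.
Hypotheses (mean_m : is_mean m) (m_cob : forall c, coboundary_le c -> 0 <= m c).

Let one_sided g M B : (forall x, `|g x| <= M) ->
  \sum_(y <- B) w y * m (fun z => g (y * z)%g) - m g
    <= M * (1 - \sum_(y <- B) w y).
Proof.
move=> gM; have bg : bounded_real g by exists M.
have bgy y : bounded_real (fun z => g (y * z)%g) by exact: bounded_real_comp.
have bwgy y : bounded_real (fun z => w y * g (y * z)%g) by exact: bounded_realZ.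
have := m_cob (coboundary_le_trunc B gM).
rewrite meanD//; [|exact/bounded_realB/bounded_real_sum|exact: bounded_real_cst].
rewrite meanB//; last exact: bounded_real_sum.
rewrite mean_cst// mean_sum//; under eq_bigr do rewrite meanZ//.
lra.
Qed.

(** A mean need not commute with infinite sums, but [Q g] converges uniformly:
    truncating it to [B] costs at most [M] times the missing mass. *)
Lemma stationary_approx g M B : (forall x, `|g x| <= M) ->
  `|m g - \sum_(y <- B) w y * m (fun z => g (y * z)%g)|
    <= M * (1 - \sum_(y <- B) w y).
Proof.
move=> gM; have bg : bounded_real g by exists M.
have bgy y : bounded_real (fun z => g (y * z)%g) by exact: bounded_real_comp.
have gNM x : `|-1 * g x| <= M by rewrite mulN1r normrN.
have := one_sided B gM; have := one_sided B gNM.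
rewrite meanZ// mulN1r; under eq_bigr do rewrite meanZ// mulN1r mulrN.
rewrite sumrN ler_norml; lra.
Qed.

Lemma stationary_harmonic g : bounded_real g ->
  real_harmonic pi (fun x => m (fun z => g (x * z)%g)).
Proof.
move=> [M gM] x e e0.
have M0 : 0 <= M by exact: le_trans (gM 1%g).
have M1 : 0 < M + 1 by rewrite ltr_wpDl.
have eM : 0 < e / (M + 1) by rewrite divr_gt0.
apply: filterS (near_sum_weight pi S_countable eM) => B wB.
have := @stationary_approx (fun z => g (x * z)%g) M B (fun z => gM _).
rewrite (eq_bigr (fun y => m (fun z => g (x * y * z)%g) * w y)); last first.
  move=> y _; rewrite mulrC; congr (m _ * _).
  by apply/funext => z; rewrite mulgA.
move=> /le_lt_trans; apply.
have : (1 - \sum_(y <- B) w y) * (M + 1) < e.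
  by rewrite -ltr_pdivlMr// ltrBlDr -ltrBlDl.
have := sum_weight_le1 pi B; rewrite mulrDr mulr1 mulrC; lra.
Qed.

End Stationary.

(** A mean that kills the coboundaries [g - Q g] turns every bounded [g] into
    the bounded harmonic function [x |-> m (z |-> g (x z))]; that it is constant
    is the invariance of the mean. *)
Lemma liouville_invariant_mean :
  (forall u, bounded_real u -> real_harmonic pi u -> forall x, u x = u 1%g) ->
  exists m : (S -> R) -> R, invariant_mean m.
Proof.
move=> L.
have [||m [mean_m m_cob]] :=
    @exists_mean R S (inhabits 1%g) coboundary_le _ _ coboundary_leD
      coboundary_leZ coboundary_le_sup.
- by move=> u [].
- split; first exact: bounded_real_cst.
  exists (fun=> 0); first exact: bounded_real_cst.
  move=> e e0; apply: filterE => B z.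
  by rewrite big1 ?subr0 ?add0r => [|y _]; [exact: ltW|rewrite mulr0].
exists m; split=> // s u bu.
rewrite (L (fun s => m (fun x => u (s * x)%g)) _ (stationary_harmonic mean_m m_cob bu)).
  by congr m; apply/funext => x; rewrite mul1g.
by have [M uM] := bu; exists M => x; apply: mean_norm => // y; exact: uM.
Qed.

End LiouvilleMean.

(** * Amenability and invariant means *)

Section AmenableMean.
Variables (R : realType) (S : monoidType).
Implicit Types (u v : S -> R) (f g : linf R S).

Lemma linf_bounded f : bounded_fun f.
Proof. by have := linfP f; rewrite inE. Qed.

Lemma linf_norm_le1 f :
  (linf_norm f <= 1)%E <-> forall x, Normc.normc (f x) <= 1.
Proof.
split=> [f1 x|f1].
  rewrite -lee_fin; apply: le_trans f1.
  by apply: ereal_sup_ubound; exists x.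
by apply: ge_ereal_sup => _ [x _ <-]; rewrite lee_fin.
Qed.

Lemma normc_le1 (z : R[i]) :
  (Normc.normc z <= 1) = (Re z ^+ 2 + Im z ^+ 2 <= 1).
Proof.
by case: z => a b /=; rewrite -{1}sqrtr1 ler_sqrt ?addr_ge0 ?sqr_ge0.
Qed.

Definition mean_functional (m : (S -> R) -> R) f : R[i] :=
  m (fun x => Re (f x)) +i* m (fun x => Im (f x)).

Lemma mean_functional_scalar m : is_mean m -> scalar (mean_functional m).
Proof.
move=> mean_m a f g.
have [bf bg] := (linf_bounded f, linf_bounded g).
have [bRf bIf] := (bounded_real_Re bf, bounded_real_Im bf).
have [bRg bIg] := (bounded_real_Re bg, bounded_real_Im bg).
rewrite /mean_functional; case: a => a b /=; simpc; congr Complex.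
- rewrite -mulNr -addrA -mean_m.1// -mean_m.1//; last exact: bounded_real_lin.
  congr m; apply/funext => x; transitivity (Re ((a +i* b) * f x + g x)) => //.
  case: (f x) => ? ?; case: (g x) => ? ? /=.
  by rewrite mulNr addrA.
- rewrite -addrA -mean_m.1// -mean_m.1//; last exact: bounded_real_lin.
  congr m; apply/funext => x; transitivity (Im ((a +i* b) * f x + g x)) => //.
  case: (f x) => ? ?; case: (g x) => ? ? /=.
  by rewrite addrA.
Qed.

(** With [phi f = a + i b], the number [a ^+ 2 + b ^+ 2] is the mean of
    [a Re f + b Im f], which the inequality of arithmetic and geometric means
    bounds by [(a ^+ 2 + b ^+ 2 + 1) / 2] when [f] lies in the unit ball. *)
Lemma mean_functional_norm m : is_mean m ->
  functional_norm (mean_functional m) = 1%E.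
Proof.
move=> mean_m; apply/le_anti/andP; split; last first.
  have one_bounded : (fun=> 1 : R[i]^o) \in bounded_pred (R := R) (S := S).
    by apply/bounded_predP; exists 1 => x; rewrite normr1.
  apply: ereal_sup_ubound; exists (Linf one_bounded).
    by apply/linf_norm_le1 => x; rewrite normc_le1/= expr1n expr0n/= addr0.
  by rewrite /mean_functional/= !mean_cst//= expr1n expr0n/= addr0 sqrtr1.
apply: ge_ereal_sup => _ [f /linf_norm_le1 f1 <-]; rewrite lee_fin normc_le1/=.
have bf := linf_bounded f.
have [bR bI] := (bounded_real_Re bf, bounded_real_Im bf).
set a := m _; set b := m _.
have : a * a + b * b <= (a ^+ 2 + b ^+ 2 + 1) / 2.
  have [baR bbI] := (bounded_realZ a bR, bounded_realZ b bI).
  have mE : m (fun x => a * Re (f x) + b * Im (f x)) = a * a + b * b.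
    by rewrite (meanD mean_m baR bbI) (meanZ mean_m _ bR) (meanZ mean_m _ bI).
  rewrite -[leLHS]mE; apply: (mean_le mean_m (bounded_realD baR bbI)) => x.
  have := f1 x; rewrite normc_le1.
  have := sqr_ge0 (a - Re (f x)); have := sqr_ge0 (b - Im (f x)).
  rewrite !sqrrB; lra.
rewrite !expr2; lra.
Qed.

Lemma invariant_mean_amenable :
  (exists m : (S -> R) -> R, invariant_mean m) -> amenable R S.
Proof.
move=> [m [mean_m inv_m]].
pose phi : {scalar linf R S} :=
  HB.pack (mean_functional m)
    (GRing.isLinear.Build _ _ _ _ _ (mean_functional_scalar mean_m)).
exists phi; split=> [f f0||a f]; last 1 first.
- have bf := linf_bounded f; congr Complex.
    by apply: (inv_m a _ (bounded_real_Re bf)).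
  by apply: (inv_m a _ (bounded_real_Im bf)).
- have bf := linf_bounded f.
  have -> : phi f = (m (fun x => Re (f x)))%:C.
    congr Complex; rewrite -[RHS](mean0 mean_m); congr m; apply/funext => x.
    exact: ger0_Im.
  rewrite ler0c; apply: mean_ge => // [|x]; first exact: bounded_real_Re.
  by have := f0 x; rewrite lecE => /andP[].
- exact: mean_functional_norm.
Qed.

(** Total in [u], as means are: unbounded functions are sent to [0]. *)
Definition linf_of_real u : linf R S := insubd 0 (fun x => (u x)%:C).

Lemma linf_of_realE u x : bounded_real u -> linf_of_real u x = (u x)%:C.
Proof.
move=> /bounded_real_complex bu; rewrite /linf_of_real.
by rewrite -[LHS]/(val (insubd _ _) x) insubdK// inE.
Qed.

Lemma linf_of_real_lin a u v : bounded_real u -> bounded_real v ->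
  linf_of_real (fun x => a * u x + v x) =
    a%:C *: linf_of_real u + linf_of_real v.
Proof.
move=> bu bv; apply: val_inj; apply/funext => x.
transitivity (a%:C * linf_of_real u x + linf_of_real v x) => //.
rewrite (linf_of_realE _ bu) (linf_of_realE _ bv).
rewrite -rmorphM -rmorphD.
exact: linf_of_realE (bounded_real_lin a bu bv).
Qed.

Section FunctionalMean.
Variable phi : {scalar linf R S}.
Hypothesis phi_ge0 : forall f, (forall x, 0 <= (f x : R[i])) -> 0 <= (phi f : R[i]).

Let phir u := phi (linf_of_real u).

Let phir_lin a u v : bounded_real u -> bounded_real v ->
  phir (fun x => a * u x + v x) = a%:C * phir u + phir v.
Proof. by move=> bu bv; rewrite /phir linf_of_real_lin// linearP. Qed.

Let phir_ge0 u : bounded_real u -> (forall x, 0 <= u x) -> 0 <= phir u.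
Proof. by move=> bu u0; apply: phi_ge0 => x; rewrite linf_of_realE// ler0c. Qed.

Let b1 : bounded_real (fun _ : S => 1 : R) := bounded_real_cst _ _.

Let phir_bound u M : bounded_real u -> (forall x, u x <= M) ->
  phir u <= M%:C * phir (fun=> 1).
Proof.
move=> bu uM; have bM : bounded_real (fun x => -1 * u x + M * 1).
  by apply: bounded_real_lin => //; exact: bounded_real_cst.
have -> : M%:C * phir (fun=> 1) = phir (fun=> M * 1).
  have -> : (fun=> M * 1) = (fun _ : S => M * 1 + 0) :> (S -> R).
    by apply/funext => x; rewrite addr0.
  rewrite (phir_lin M b1 (bounded_real_cst _ _)).
  have -> : (fun _ : S => 0) = (fun _ : S => -1 * 1 + 1) :> (S -> R).
    by apply/funext => x; rewrite mulN1r addNr.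
  by rewrite phir_lin// rmorphN1 mulN1r addNr addr0.
have := @phir_ge0 (fun x => -1 * u x + M * 1) bM.
rewrite phir_lin//; last exact: bounded_real_cst.
rewrite rmorphN1 mulN1r addrC subr_ge0; apply => x.
by rewrite mulN1r mulr1 addrC subr_ge0.
Qed.

Let phir1_real : phir (fun=> 1) = (Re (phir (fun=> 1)))%:C.
Proof. by rewrite RRe_real// ger0_real// phir_ge0. Qed.

Lemma mean_of_functional : Re (phi (linf_of_real (fun=> 1))) != 0 ->
  is_mean (fun u => Re (phi (linf_of_real u)) / Re (phi (linf_of_real (fun=> 1)))).
Proof.
rewrite -/(phir _) => k0; split=> [a u v bu bv|u c bu uc].
  rewrite -!/(phir _) phir_lin//; case: (phir u) => ? ?; case: (phir v) => ? ? /=.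
  by rewrite mul0r subr0 mulrDl mulrA.
have k_gt0 : 0 < Re (phir (fun=> 1)).
  rewrite lt_def k0/=; have := phir_ge0 b1 (fun=> ler01).
  by rewrite lecE => /andP[].
rewrite -!/(phir _) ler_pdivrMr//; have := phir_bound bu uc.
rewrite {1}phir1_real -rmorphM lecE => /andP[_]. by [].
Qed.

(** If [phi] vanished at the constant [1], positivity would make it vanish at
    all real, hence at all complex bounded functions. *)
Lemma functional_norm_neq0 : functional_norm phi != 0%E ->
  Re (phi (linf_of_real (fun=> 1))) != 0.
Proof.
apply: contra_neq; rewrite -/(phir _) => k0.
have phi1 : phir (fun=> 1) = 0 by rewrite phir1_real k0.
have phir_le0 u : bounded_real u -> phir u <= 0.
  move=> bu; have [M uM] := bu; rewrite (le_trans (@phir_bound u M bu _))//.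
    by move=> x; exact: le_trans (ler_norm _) (uM x).
  by rewrite phi1 mulr0.
have phir0 u : bounded_real u -> phir u = 0.
  move=> bu; apply/le_anti; rewrite phir_le0//=.
  have := phir_le0 _ (bounded_real_lin (-1) bu b1).
  by rewrite (phir_lin (-1) bu b1) phi1 addr0 rmorphN1 mulN1r oppr_le0.
have phi0 f : phi f = 0.
  have bf := linf_bounded f.
  have [bR bI] := (bounded_real_Re bf, bounded_real_Im bf).
  have -> : f = 'i *: linf_of_real (fun x => Im (f x))
                + linf_of_real (fun x => Re (f x)).
    apply: val_inj; apply/funext => x.
    transitivity ('i * linf_of_real (fun x => Im (f x)) x
                  + linf_of_real (fun x => Re (f x)) x); last by [].
    rewrite (linf_of_realE _ bR) (linf_of_realE _ bI) addrC.
    exact: complexE.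
  by rewrite linearP -!/(phir _) !phir0//= mulr0 addr0.
rewrite /functional_norm (_ : [set _ | _ in _] = [set 0%E]) ?ereal_sup1//.
apply/seteqP; split=> [_ [f _ <-]|_ ->]; first by rewrite phi0 Normc.normc0.
exists (linf_of_real (fun=> 0)); last by rewrite phi0 Normc.normc0.
apply/linf_norm_le1 => x; rewrite linf_of_realE; last exact: bounded_real_cst.
by rewrite Normc.normc0.
Qed.

End FunctionalMean.
(** Positivity and a nonzero value at the constant [1], by which one divides,
    make the real part of the functional a mean. *)
Lemma amenable_invariant_mean : amenable R S ->
  exists m : (S -> R) -> R, invariant_mean m.
Proof.
move=> [phi [phi_ge0 phi_norm phi_inv]].
have k0 : Re (phi (linf_of_real (fun=> 1))) != 0.
  by apply: functional_norm_neq0; rewrite // phi_norm.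
exists (fun u => Re (phi (linf_of_real u)) / Re (phi (linf_of_real (fun=> 1)))).
split=> [|s u bu]; first exact: mean_of_functional.
rewrite -(phi_inv s (linf_of_real u)); congr (Re (phi _) / _).
apply: val_inj; apply/funext => x.
rewrite [LHS]linf_of_realE; last exact: bounded_real_comp.
by rewrite [RHS]linf_of_realE.
Qed.

End AmenableMean.

(** * From an invariant mean to almost invariant measures *)

Section FiniteReiter.
Variables (R : realType) (S : monoidType).
Implicit Types (l : seq (R * S)) (u b : S -> R).

(** A list of weighted points stands for the measure with these atoms; points
    may be repeated, so that measures add up by concatenation. *)
Definition integ l u := \sum_(p <- l) p.1 * u p.2.

Definition nonneg l := all (fun p => 0 <= p.1) l.

Definition finite_prob l := nonneg l /\ \sum_(p <- l) p.1 = 1.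

(** The Reiter condition for finitely supported measures, the total variation
    norm being tested dually, on functions bounded by [1]. *)
Definition finite_reiter := forall (F : seq S) e, 0 < e ->
  exists2 l, finite_prob l & forall s b, s \in F -> (forall x, `|b x| <= 1) ->
    integ l (fun t => b t - b (s * t)%g) <= e.

Definition rescale (a : R) l := [seq (a * p.1, p.2) | p <- l].

Lemma integ_rescale a l u : integ (rescale a l) u = a * integ l u.
Proof.
by rewrite /integ big_map mulr_sumr; apply: eq_bigr => p _; rewrite mulrA.
Qed.

Lemma integ_cat l l' u : integ (l ++ l') u = integ l u + integ l' u.
Proof. exact: big_cat. Qed.

Lemma nonneg_rescale a l : 0 <= a -> nonneg l -> nonneg (rescale a l).
Proof.
move=> a0 /allP l0; apply/allP => _ /mapP[p pl ->] /=.
by rewrite mulr_ge0// l0.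
Qed.

Lemma integ_le l u v : nonneg l -> (forall x, u x <= v x) ->
  integ l u <= integ l v.
Proof.
move=> /allP l0 uv; rewrite /integ !big_seq; apply: ler_sum => p pl.
by rewrite ler_wpM2l// l0.
Qed.

Lemma integB l u v : integ l (fun x => u x - v x) = integ l u - integ l v.
Proof. by rewrite /integ -sumrB; apply: eq_bigr => p _; rewrite mulrBr. Qed.

Lemma integ_cst l c : integ l (fun=> c) = (\sum_(p <- l) p.1) * c.
Proof. by rewrite /integ mulr_suml. Qed.

Section Minimax.
Variables (F : seq S) (e : R).
Hypothesis F_uniq : uniq F.
Hypothesis e0 : 0 < e.

Let test := {b : S -> S -> R | forall s x, `|b s x| <= 1}.

(* [b] assigns a test function to every [s]; integrating its defect against
   [theta] pairs [b] with the family of signed measures [theta - s theta]. *)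
Let defect (b : S -> S -> R) t := \sum_(s <- F) (b s t - b s (s * t)%g).

Let bounded_eval s t : bounded_real (fun b : test => sval b s t).
Proof. by exists 1 => b; exact: (svalP b). Qed.

Let bounded_defect t : bounded_real (fun b : test => defect (sval b) t).
Proof. by apply: bounded_real_sum => s; exact: bounded_realB. Qed.

Let cone : set (test -> R) := [set c | exists2 l, nonneg l &
  c = (fun b : test => integ l (fun t => defect (sval b) t - e))].

(** If no finitely supported probability works, the cone generated by the
    functions [b |-> defect b t - e], on the set of families of test functions,
    has nonnegative suprema. A mean that is nonnegative on this cone has a
    barycenter [f], a single family of test functions whose defect is at least
    [e] everywhere; an invariant mean integrates this defect to [0]. *)
Lemma invariant_mean_minimax (mu : (S -> R) -> R) : invariant_mean mu ->
  exists2 l, finite_prob l & forall s b, s \in F -> (forall x, `|b x| <= 1) ->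
    integ l (fun t => b t - b (s * t)%g) <= e.
Proof.
move=> [mean_mu inv_mu]; apply: contrapT => noprob.
have zero_le1 (s x : S) : `|0 : R| <= 1 by rewrite normr0.
have [||||||m [mean_m m_cone]] := @exists_mean R test _ cone.
- by apply: inhabits; exists (fun _ _ => 0).
- move=> _ [l _ ->]; apply: bounded_real_sum => p; apply: bounded_realZ.
  exact: bounded_realB (bounded_real_cst _ _).
- exists [::] => //; apply/funext => b.
  by rewrite /integ big_nil.
- move=> _ _ [l l0 ->] [l' l'0 ->]; exists (l ++ l').
    by rewrite /nonneg all_cat; apply/andP.
  by apply/funext => b; rewrite integ_cat.
- move=> a _ a0 [l l0 ->]; exists (rescale a l); first exact: nonneg_rescale.
  by apply/funext => b; rewrite integ_rescale.
- move=> _ [l l0 ->] d d0; pose W := \sum_(p <- l) p.1.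
  have W0 : 0 <= W by rewrite /W big_seq; apply: sumr_ge0 => p /(allP l0).
  move: W0; rewrite le_eqVlt => /predU1P[W0|W_gt0].
    exists (exist _ (fun _ _ => 0) zero_le1) => /=.
    rewrite (_ : defect _ = fun=> 0); last first.
      by apply/funext => t; rewrite /defect big1// => s _; rewrite subrr.
    by rewrite integ_cst -/W -W0 mul0r oppr_lt0.
  pose l' := rescale W^-1 l.
  have l'p : finite_prob l'.
    split; first by apply: nonneg_rescale => //; rewrite invr_ge0 ltW.
    by rewrite big_map -mulr_sumr mulVf// gt_eqF.
  have [s [b [sF b1 lb]]] : exists s b, [/\ s \in F, forall x, `|b x| <= 1 &
      e < integ l' (fun t => b t - b (s * t)%g)].
    apply: contrapT => h; apply: noprob; exists l' => // s b sF b1.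
    by rewrite leNgt; apply/negP => h'; apply: h; exists s, b.
  (* A violated inequality is turned into a family of test functions that is
     nonzero only at [s]. *)
  pose B s' x := if s' == s then b x else 0.
  have B1 s' x : `|B s' x| <= 1 by rewrite /B; case: ifP; rewrite ?normr0.
  exists (exist _ B B1) => /=.
  have -> : defect B = fun t => b t - b (s * t)%g.
    apply/funext => t; rewrite /defect (bigD1_seq s)//= /B eqxx big1 ?addr0//.
    by move=> s' /negPf ->; rewrite subrr.
  move: lb; rewrite integ_rescale ltr_pdivlMl//.
  have := integB l (fun t => b t - b (s * t)%g) (fun=> e).
  rewrite integ_cst -/W => -> lWe.
  by apply: (@lt_trans _ _ 0); rewrite ?oppr_lt0// subr_gt0.
pose f s t := m (fun b : test => sval b s t).
have f1 s t : `|f s t| <= 1 by apply: mean_norm => // b; exact: (svalP b).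
have bf s : bounded_real (f s) by exists 1.
have bfs s : bounded_real (fun t => f s t - f s (s * t)%g).
  by apply: bounded_realB => //; exact: bounded_real_comp.
have fe t : e <= \sum_(s <- F) (f s t - f s (s * t)%g).
  rewrite -subr_ge0; have := m_cone (fun b : test => defect (sval b) t - e).
  rewrite meanB// ?mean_cst//; last exact: bounded_real_cst.
  rewrite (mean_sum mean_m); last by move=> s; exact: bounded_realB.
  under eq_bigr do rewrite meanB//.
  apply; exists [:: (1, t)]; first by rewrite /nonneg /= ler01.
  by apply/funext => b; rewrite /integ big_seq1 mul1r.
have := mean_ge mean_mu (bounded_real_sum F bfs) fe.
rewrite mean_sum// big1 ?leNgt ?e0// => s _.
rewrite meanB//; last exact: bounded_real_comp.
by rewrite inv_mu// subrr.
Qed.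

End Minimax.

Lemma invariant_mean_finite_reiter :
  (exists m : (S -> R) -> R, invariant_mean m) -> finite_reiter.
Proof.
move=> [mu inv_mu] F e e0.
have [l pl lF] := invariant_mean_minimax (undup_uniq F) e0 inv_mu.
by exists l => // s b sF b1; apply: lF; rewrite ?mem_undup.
Qed.

End FiniteReiter.

(** * Measures from weights *)

Section Measures.
Variables (R : realType) (S : monoidType).
Implicit Types (l : seq (R * S)) (pi : probability (discrete S) R).

Lemma finite_prob_measure l : finite_prob l ->
  exists pi, forall A : set (discrete S),
    pi A = (integ l (fun t => (t \in A)%:R))%:E.
Proof.
move=> [/allP l0 l1].
pose mu := msum (fun k => mscale (NngNum (normr_ge0 (nth (0, 1%g) l k).1))
  (dirac ((nth (0, 1%g) l k).2 : discrete S))) (size l).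
have muE (A : set (discrete S)) : mu A = (integ l (fun t => (t \in A)%:R))%:E.
  rewrite /mu /msum /integ (big_nth (0, 1%g)) big_mkord -sumEFin.
  apply: eq_bigr => k _; set p := nth (0, 1%g) l k.
  transitivity (`|p.1|%:E * ((p.2 : discrete S) \in A)%:R%:E)%E => //.
  rewrite -EFinM ger0_norm//.
  by apply: l0; exact: mem_nth.
have mu1 : mu [set: discrete S] = 1%E.
  rewrite muE /integ; congr (_%:E); rewrite -[RHS]l1.
  by apply: eq_bigr => p _; rewrite in_setT mulr1.
pose M := Measure_isProbability.Build _ _ _ mu mu1.
pose P : probability (discrete S) R := HB.pack mu M.
by exists P.
Qed.

Lemma mixture_measure (pi_ : nat -> probability (discrete S) R) :
  exists pi, forall A : set (discrete S),
    pi A = (\sum_(k <oo) (2^-1 ^+ k.+1)%:E * pi_ k A)%E.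
Proof.
have h0 k : 0 <= (2^-1 ^+ k.+1 : R) by rewrite exprn_ge0.
pose mu := mseries (fun k => mscale (NngNum (h0 k)) (pi_ k)) 0.
have mu1 : mu [set: discrete S] = 1%E.
  rewrite /mu /mseries; apply/cvg_lim => //.
  have := @cvg_geometric_eseries_half R 1 0; rewrite expr0 divr1.
  apply: cvg_trans; apply: near_eq_cvg; apply: nearW => n.
  rewrite /eseries/=; apply: eq_bigr => k _.
  have piT : pi_ k [set: discrete S] = 1%E := probability_setT (pi_ k).
  by rewrite /mscale/= piT mule1 addn1 mul1r natrX exprVn.
pose M := Measure_isProbability.Build _ _ _ mu mu1.
pose P : probability (discrete S) R := HB.pack mu M.
by exists P.
Qed.

End Measures.

(** * Total variation and test functions *)

Section Reiter.
Variables (R : realType) (S : monoidType).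
Implicit Types (l : seq (R * S)) (pi : probability (discrete S) R) (b : S -> R).

Lemma sum_fset_delta (B : {fset S}) (g : S -> R) y :
  \sum_(x <- B) g x * (y == x)%:R = if y \in B then g y else 0.
Proof.
case: ifPn => yB.
  rewrite (bigD1_seq y)//= eqxx mulr1 big1 ?addr0// => x xy.
  by rewrite eq_sym (negPf xy) mulr0.
rewrite big_seq big1// => x xB.
by rewrite (_ : y == x = false) ?mulr0//; apply: contraNF yB => /eqP ->.
Qed.

Lemma l1_distance_le pi (s : S) e :
  (forall B : {fset S}, \sum_(x <- B)
     `|fine (pi [set x]) - fine (left_translate s pi [set x])| <= e) ->
  (l1_distance pi (left_translate s pi) <= e%:E)%E.
Proof.
move=> h; apply: ge_ereal_sup => _ [X [Xfin _] <-].
rewrite fsbig_finite//= (eq_bigr (fun x => `|fine (pi [set x]) -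
  fine (left_translate s pi [set x])|%:E)); last first.
  move=> x _; rewrite -abse_EFin EFinB /left_translate /pushforward.
  by rewrite !probability_fineK.
by rewrite sumEFin lee_fin.
Qed.

(** The total variation norm is the supremum over test functions: against the
    signs of the difference, a test integral becomes a partial sum of the
    norm. *)
Lemma test_l1_distance l pi (s : S) e :
  (forall A : set (discrete S), pi A = (integ l (fun t => (t \in A)%:R))%:E) ->
  (forall b, (forall x, `|b x| <= 1) ->
    integ l (fun t => b t - b (s * t)%g) <= e) ->
  (l1_distance pi (left_translate s pi) <= e%:E)%E.
Proof.
move=> piE le; apply: l1_distance_le => B.
pose D x := integ l (fun t => (t == x)%:R - (s * t == x)%g%:R).
have DE x : fine (pi [set x]) - fine (left_translate s pi [set x]) = D x.
  rewrite /left_translate /pushforward !piE /D integB; congr (_ - _).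
    apply: eq_bigr => p _; congr (_ * _%:R); congr nat_of_bool.
    by apply/idP/eqP; rewrite inE.
  apply: eq_bigr => p _; congr (_ * _%:R); congr nat_of_bool.
  by apply/idP/eqP; rewrite inE.
pose b y := if y \in B then Num.sg (D y) else 0.
have b1 y : `|b y| <= 1.
  by rewrite /b; case: ifP => _; rewrite ?normr0// normr_sg lern1; case: eqP.
apply: le_trans (le _ b1); rewrite le_eqVlt; apply/orP; left; apply/eqP.
transitivity (\sum_(x <- B) Num.sg (D x) * D x).
  by apply: eq_bigr => x _; rewrite DE -normrEsg.
transitivity (integ l (fun t => \sum_(x <- B)
    Num.sg (D x) * ((t == x)%:R - (s * t == x)%g%:R))).
  rewrite /integ; under [RHS]eq_bigr do rewrite mulr_sumr.
  rewrite exchange_big/=; apply: eq_bigr => x _; rewrite /D /integ mulr_sumr.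
  by apply: eq_bigr => p _; rewrite mulrCA.
apply: eq_bigr => p _; congr (_ * _).
by under eq_bigr do rewrite mulrBr; rewrite sumrB !sum_fset_delta.
Qed.

(** The [n]-th measure is almost invariant, up to [1 / (n + 1)], under the first
    elements of an enumeration. *)
Lemma finite_reiter_reiter :
  countable [set: S] -> finite_reiter R S -> reiter R S.
Proof.
move=> /countable_injP[f finj] FR.
have Ffin n : finite_set [set x : S | (f x <= n)%N].
  apply: (@finite_preimage _ _ `I_n.+1 f) (finite_II n.+1) => x y _ _.
  by apply: finj; rewrite inE.
have theta n : exists pi : probability (discrete S) R, forall s, (f s <= n)%N ->
    (l1_distance pi (left_translate s pi) <= (n.+1%:R^-1)%:E)%E.
  have n0 : 0 < (n.+1%:R^-1 : R) by rewrite invr_gt0.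
  have [l lp lF] := FR (fset_set [set x : S | (f x <= n)%N]) _ n0.
  have [pi piE] := finite_prob_measure lp; exists pi => s sn.
  apply: test_l1_distance piE _ => b b1; apply: lF => //.
  by rewrite in_fset_set// inE.
have [theta_ thetaP] := choice theta; exists theta_ => s.
apply: (@squeeze_cvge _ _ _ _ (cst 0%E) _ (EFin \o @harmonic R)).
- exists (f s) => // n /= sn; rewrite thetaP// andbT.
  exact: esum_ge0.
- exact: cvg_cst.
- exact: cvge_harmonic.
Qed.

End Reiter.

Section Truncation.
Variables (R : realType) (S : monoidType).
Variables (pi : probability (discrete S) R) (s : S).
Implicit Types (B X : {fset S}) (b : S -> R).
Local Notation w := (weight pi).
Local Notation ws x := (fine (left_translate s pi [set x])).

Lemma sum_l1_distance X e :
  (l1_distance pi (left_translate s pi) <= e%:E)%E ->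
  \sum_(x <- X) `|w x - ws x| <= e.
Proof.
move=> le; rewrite -lee_fin -sumEFin; apply: le_trans le.
apply: esum_ge; exists [set` X]; first by split.
rewrite fsbig_finite//= set_fsetK le_eqVlt; apply/orP; left; apply/eqP.
apply: eq_bigr => x _; rewrite -abse_EFin EFinB /left_translate /pushforward.
by rewrite !probability_fineK.
Qed.

Lemma sum_translate_le1 X : \sum_(x <- X) ws x <= 1.
Proof.
rewrite -lee_fin -sumEFin /left_translate /pushforward.
under eq_bigr do rewrite probability_fineK.
rewrite -(@measure_fbigsetU _ _ _ pi S X
  (fun x => (fun t : discrete S => (s * t)%g : discrete S) @^-1` [set x]))//.
  exact: probability_le1.
by move=> x y _ _ [z [/= -> ->]].
Qed.

Lemma sum_fiber_le B x : \sum_(t <- B) w t * (s * t == x)%g%:R <= ws x.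
Proof.
rewrite -(@big_fset_incl _ _ _ _ [fset t in B | (s * t == x)%g]%fset B).
- rewrite (eq_big_seq w) => [|t].
    rewrite -lee_fin sum_weight /left_translate /pushforward probability_fineK.
    by apply: le_measure; rewrite ?inE// => t /=; rewrite !inE => /andP[_ /eqP].
  by rewrite !inE => /andP[_ ->]; rewrite mulr1.
- by apply/fsubsetP => t; rewrite !inE => /andP[].
- by move=> t tB; rewrite !inE tB/= => /negPf ->; rewrite mulr0.
Qed.

(** Passing to the finite set [B] loses mass at most [e] in [pi] and in its
    translate, which adds [2 e] to the norm of their difference. *)
Lemma truncated_translate_le B b e :
  (l1_distance pi (left_translate s pi) <= e%:E)%E ->
  1 - e < \sum_(t <- B) w t -> (forall x, `|b x| <= 1) ->
  \sum_(t <- B) w t * (b t - b (s * t)%g) <= e * 3.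
Proof.
move=> dist_le WB b1.
pose X := (B `|` [fset (s * t)%g | t in B])%fset.
have BX : (B `<=` X)%fset by exact: fsubsetUl.
have sX t : t \in B -> (s * t)%g \in X.
  by move=> tB; rewrite in_fsetU; apply/orP; right; apply/imfsetP; exists t.
pose v x := \sum_(t <- B) w t * (s * t == x)%g%:R.
(* [v] is the translate of the restriction of [pi] to [B]. *)
have fiberE (g : S -> R) :
    \sum_(t <- B) w t * g (s * t)%g = \sum_(x <- X) g x * v x.
  under [RHS]eq_bigr do rewrite mulr_sumr.
  rewrite exchange_big/= big_seq [RHS]big_seq; apply: eq_bigr => t tB.
  under eq_bigr do rewrite mulrCA.
  by rewrite -mulr_sumr sum_fset_delta sX.
have WE : \sum_(t <- B) w t = \sum_(x <- X) v x.
  have := fiberE (fun=> 1); under eq_bigr do rewrite mulr1.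
  by under [in RHS]eq_bigr do rewrite mul1r.
have diff_le : \sum_(x <- X) (b x * w x - b x * v x) <=
    \sum_(x <- X) (`|w x - ws x| + (ws x - v x)).
  apply: ler_sum => x _; have bx := b1 x.
  have h1 : b x * (w x - ws x) <= `|w x - ws x|.
    apply: le_trans (ler_norm _) _; rewrite normrM.
    by rewrite ler_piMl.
  have h2 : b x * (ws x - v x) <= ws x - v x.
    rewrite ler_piMl ?subr_ge0 ?sum_fiber_le//.
    exact: le_trans (ler_norm _) bx.
  rewrite (_ : _ - _ = b x * (w x - ws x) + b x * (ws x - v x)) ?lerD//.
  by rewrite -mulrDr addrA subrK mulrBr.
have tail_le : - \sum_(x <- (X `\` B)%fset) b x * w x <=
    \sum_(x <- (X `\` B)%fset) w x.
  rewrite -sumrN; apply: ler_sum => x _.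
  rewrite -mulNr ler_piMl ?weight_ge0//.
  by apply: le_trans (b1 x); rewrite -normrN ler_norm.
rewrite (eq_bigr (fun t => b t * w t - w t * b (s * t)%g)); last first.
  by move=> t _; rewrite mulrBr mulrC.
rewrite sumrB fiberE.
have := sum_weight_le1 pi X; rewrite (sum_fset_split _ BX).
have := sum_translate_le1 X; have := sum_l1_distance X dist_le.
move: diff_le; rewrite sumrB [in leRHS]big_split/= sumrB -WE.
rewrite (sum_fset_split (fun x => b x * w x) BX).
lra.
Qed.

End Truncation.

(** Restricting a term of the sequence to a finite set of mass [W > 1 / 2] and
    normalizing multiplies the error [3 d] by at most [2]; hence the choice
    [d <= e / 6]. *)
Lemma reiter_finite_reiter (R : realType) (S : monoidType) :
  countable [set: S] -> reiter R S -> finite_reiter R S.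
Proof.
move=> cS [theta thetaP] F e e0.
pose d := Num.min (e / 6) (1 / 2).
have d0 : 0 < d by rewrite lt_min !divr_gt0.
have : \forall n \near \oo, forall s, s \in F ->
    (l1_distance (theta n) (left_translate s (theta n)) <= d%:E)%E.
  elim: F => [|s F IH]; first by apply: nearW => n s.
  have sn : \forall n \near \oo,
      (l1_distance (theta n) (left_translate s (theta n)) <= d%:E)%E.
    have nbh0 : nbhs (0%E : \bar R) [set x | (x < d%:E)%E].
      by apply: open_nbhs_nbhs; split; [exact: open_ereal_lt_ereal|].
    have [N _ near0] := thetaP s _ nbh0.
    by exists N => // n Nn; exact: ltW (near0 n Nn).
  apply: filterS2 IH sn => n IH sn t; rewrite inE => /predU1P[->//|].
  exact: IH.
move=> /filter_ex[n thetan].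
have [B BW] := filter_ex (near_sum_weight (theta n) cS d0).
pose W := \sum_(t <- B) weight (theta n) t.
have d2 : d <= 1 / 2 by rewrite /d ge_min lexx orbT.
have d6 : d <= e / 6 by rewrite /d ge_min lexx.
have W2 : 1 / 2 < W by rewrite /W; rewrite /= in BW; lra.
have W0 : 0 < W by lra.
exists [seq (W^-1 * weight (theta n) t, t) | t <- B].
  split; last by rewrite big_map -mulr_sumr mulVf// gt_eqF.
  apply/allP => _ /mapP[t _ ->] /=.
  by rewrite mulr_ge0 ?weight_ge0// invr_ge0 ltW.
move=> s b sF b1; rewrite /integ big_map/=.
under eq_bigr do rewrite -mulrA.
rewrite -mulr_sumr ler_pdivrMl//.
apply: le_trans (truncated_translate_le (thetan s sF) BW b1) _.
by have : 1 / 2 * e <= W * e; [rewrite ler_wpM2r ?ltW|lra].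
Qed.

(** * Harmonic functions of a mixture *)

Section Mixture.
Variables (R : realType) (S : monoidType).
Variables (theta : nat -> seq (R * S)) (pi : probability (discrete S) R).
Hypothesis theta_prob : forall k, finite_prob (theta k).
Hypothesis piE : forall A : set (discrete S), pi A =
  (\sum_(k <oo) (2^-1 ^+ k.+1)%:E * (integ (theta k) (fun t => (t \in A)%:R))%:E)%E.
Implicit Types (v : S -> R).
Local Notation w := (weight pi).

Lemma sum_half n : \sum_(k < n) 2^-1 ^+ k.+1 = 1 - 2^-1 ^+ n :> R.
Proof.
elim: n => [|n IH]; first by rewrite big_ord0 expr0 subrr.
by rewrite big_ord_recr/= IH exprS; lra.
Qed.

Lemma half_ge0 n : 0 <= 2^-1 ^+ n :> R.
Proof. by rewrite exprn_ge0. Qed.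

Definition partial_weight N y :=
  \sum_(k < N) 2^-1 ^+ k.+1 * integ (theta k) (fun t => (t == y)%:R).

Lemma integ_ge0 k v : (forall x, 0 <= v x) -> 0 <= integ (theta k) v.
Proof.
move=> v0; have := integ_le (theta_prob k).1 v0.
by rewrite integ_cst mulr0.
Qed.

Lemma partial_weight_le N y : partial_weight N y <= w y.
Proof.
rewrite -lee_fin /weight probability_fineK piE -sumEFin.
have E k : (2^-1 ^+ k.+1 * integ (theta k) (fun t => (t == y)%:R))%:E =
    ((2^-1 ^+ k.+1)%:E * (integ (theta k) (fun t => (t \in [set y])%:R))%:E)%E.
  rewrite EFinM; congr (_ * (integ _ _)%:E)%E; apply/funext => t.
  by congr (_%:R); congr nat_of_bool; apply/eqP/idP; rewrite inE.
under eq_bigr do rewrite E; rewrite -(big_mkord xpredT (fun k =>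
  (2^-1 ^+ k.+1)%:E * (integ (theta k) (fun t => (t \in [set y])%:R))%:E)%E).
apply: nneseries_lim_ge => k _ _; rewrite -EFinM lee_fin mulr_ge0 ?half_ge0//.
exact: integ_ge0.
Qed.

Lemma integ_fset k v (B : {fset S}) : (forall p, p \in theta k -> p.2 \in B) ->
  integ (theta k) v =
  \sum_(y <- B) v y * integ (theta k) (fun t => (t == y)%:R).
Proof.
move=> tB; under [RHS]eq_bigr do rewrite mulr_sumr.
rewrite exchange_big/= /integ big_seq [RHS]big_seq; apply: eq_bigr => p pk.
under eq_bigr do rewrite mulrCA.
by rewrite -mulr_sumr sum_fset_delta tB.
Qed.

(** The first [N] components of the mixture carry all but [2^-N] of its mass. *)
Lemma mixture_approx v l M N : (forall y, `|v y| <= M) ->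
  real_sum (fun y => v y * w y) l ->
  `|l - \sum_(k < N) 2^-1 ^+ k.+1 * integ (theta k) v| <= M * 2^-1 ^+ N.
Proof.
move=> vM lv; apply/ler_addgt0Pr => e e0.
pose B0 := [fset y in flatten [seq [seq p.2 | p <- theta k] | k <- iota 0 N]]%fset.
have [B [Bl B0B]] := filter_ex (filterI (lv _ e0) (near_fset_ge B0)).
rewrite /= in Bl B0B.
have tB k p : (k < N)%N -> p \in theta k -> p.2 \in B.
  move=> kN pk; apply: (fsubsetP B0B); rewrite inE; apply/flattenP.
  exists [seq p.2 | p <- theta k]; last by apply: map_f.
  by apply: map_f; rewrite mem_iota.
have partE u : \sum_(k < N) 2^-1 ^+ k.+1 * integ (theta k) u =
    \sum_(y <- B) u y * partial_weight N y.
  rewrite (eq_bigr (fun k : 'I_N => \sum_(y <- B) u y *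
      (2^-1 ^+ k.+1 * integ (theta k) (fun t => (t == y)%:R)))); last first.
    move=> k _; rewrite (@integ_fset k u B) => [|p]; last exact: tB.
    by rewrite mulr_sumr; apply: eq_bigr => y _; rewrite mulrCA.
  by rewrite exchange_big/=; apply: eq_bigr => y _; rewrite mulr_sumr.
have massE : \sum_(y <- B) partial_weight N y = 1 - 2^-1 ^+ N.
  have := partE (fun=> 1); under [in RHS]eq_bigr do rewrite mul1r.
  move=> <-; rewrite -sum_half; apply: eq_bigr => k _.
  by rewrite integ_cst (theta_prob k).2 !mulr1.
have diff_le : `|\sum_(y <- B) v y * w y - \sum_(y <- B) v y * partial_weight N y|
    <= M * 2^-1 ^+ N.
  rewrite -sumrB; apply: le_trans (ler_norm_sum _ _ _) _.
  have : \sum_(y <- B) `|v y * w y - v y * partial_weight N y| <=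
      M * \sum_(y <- B) (w y - partial_weight N y).
    rewrite mulr_sumr; apply: ler_sum => y _.
    rewrite -mulrBr normrM (ger0_norm (x := _ - _)) ?subr_ge0 ?partial_weight_le//.
    by rewrite ler_wpM2r// subr_ge0 partial_weight_le.
  move=> /le_trans; apply; rewrite ler_wpM2l//; first exact: le_trans (vM 1%g).
  by rewrite sumrB massE; have := sum_weight_le1 pi B; lra.
rewrite partE; move: diff_le Bl; set a := \sum_(y <- B) v y * w y.
set c := \sum_(y <- B) _ => h1 h2.
rewrite (_ : l - c = (l - a) + (a - c)); last by rewrite addrA subrK.
by apply: le_trans (ler_normD _ _) _; rewrite addrC lerD// ltW.
Qed.

End Mixture.

(** Bernoulli's inequality in the form [(1 - d) ^+ n <= 1 / (1 + n d)]. *)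
Lemma bernoulli_inv (R : realFieldType) (d : R) n : 0 <= d -> d <= 1 ->
  (1 - d) ^+ n * (1 + n%:R * d) <= 1.
Proof.
move=> d0 d1; elim: n => [|n IH]; first by rewrite expr0 mul0r addr0 mulr1.
apply: le_trans IH; rewrite exprSr -mulrA ler_wpM2l//.
  by rewrite exprn_ge0// subr_ge0.
rewrite -natr1; have := mulr_ge0 (ler0n R n) (mulr_ge0 d0 d0).
have := mulr_ge0 d0 d0; lra.
Qed.

Section KaimanovichVershik.
Variables (R : realType) (S : monoidType).
Implicit Types (K : seq S) (x y : S) (u v : S -> R).

(** Products of [n + 1] elements of [K]. *)
Fixpoint products K n : seq S :=
  if n is n'.+1 then [seq (x * y)%g | x <- products K n', y <- K] else K.

Lemma mem_products_mul K n x y :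
  x \in products K n -> y \in K -> (x * y)%g \in products K n.+1.
Proof. by move=> xK yK; apply/allpairsP; exists (x, y). Qed.

Lemma products_mono K K' m n : 1%g \in K' -> {subset K <= K'} -> (m <= n)%N ->
  {subset products K m <= products K' n}.
Proof.
move=> K1 KK' /subnKC <-; elim: (n - m)%N => [|d IH].
  rewrite addn0 => {n}; elim: m => [|m IH] x //=; first exact: KK'.
  by move=> /allpairsP[[y z] /= [/IH yK /KK' zK ->]]; exact: mem_products_mul.
by move=> x /IH xK; rewrite addnS -[x]mulg1; exact: mem_products_mul.
Qed.

Variable elt : nat -> S.
Hypothesis elt_surj : forall x, exists n, elt n = x.
Variable almost_inv : seq S -> nat -> seq (R * S).
Hypothesis almost_inv_prob : forall K k, finite_prob (almost_inv K k).
Hypothesis almost_inv_le : forall K k s b, s \in K -> (forall x, `|b x| <= 1) ->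
  integ (almost_inv K k) (fun t => b t - b (s * t)%g) <= k.+1%:R^-1.

(** Large enough for [(1 - 2^-k) ^+ depth k <= 1 / (k + 1)], by Bernoulli's
    inequality. *)
Definition depth k := (k * 2 ^ k)%N.

(** The elements met before stage [k]: the first [k] elements of the enumeration
    and the supports of the measures chosen so far. The next measure is almost
    invariant under all products of [depth k + 1] of them. *)
Fixpoint known k : seq S :=
  if k is k'.+1 then
    elt k' :: known k' ++
      [seq p.2 | p <- almost_inv (products (known k') (depth k')) k']
  else [:: 1%g].

Definition stage k := almost_inv (products (known k) (depth k)) k.

Lemma known1 k : 1%g \in known k.
Proof.
elim: k => [|k IH]; first exact: mem_head.
by rewrite inE mem_cat IH orbT.
Qed.

Lemma known_mono i k : (i <= k)%N -> {subset known i <= known k}.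
Proof.
move=> /subnKC <-; elim: (k - i)%N => [|d IH] x; first by rewrite addn0.
by move=> /IH xd; rewrite addnS inE mem_cat xd orbT.
Qed.

Lemma elt_known i k : (i < k)%N -> elt i \in known k.
Proof. by move=> ik; apply: (known_mono ik); exact: mem_head. Qed.

Lemma stage_known i k p : (i < k)%N -> p \in stage i -> p.2 \in known k.
Proof.
move=> ik pi; apply: (known_mono ik); rewrite inE mem_cat.
by apply/orP; right; apply/orP; right; exact: map_f.
Qed.

Lemma depth_mono i k : (i <= k)%N -> (depth i <= depth k)%N.
Proof. by move=> ik; rewrite leq_mul// leq_exp2l. Qed.

Lemma stage_inv i k u M x : 0 < M -> (forall y, `|u y| <= M) ->
  (i <= k)%N -> x \in products (known i) (depth i) ->
  integ (stage k) (fun t => u t - u (x * t)%g) <= M * i.+1%:R^-1.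
Proof.
move=> M0 uM ik xi.
have xk : x \in products (known k) (depth k).
  by apply: (products_mono (known1 k) (known_mono ik) (depth_mono ik) xi).
have b1 y : `|M^-1 * u y| <= 1.
  by rewrite normrM gtr0_norm ?invr_gt0// ler_pdivrMl ?mulr1.
have := almost_inv_le k xk b1; rewrite -/(stage k) => h.
rewrite -ler_pdivrMl//; apply: le_trans (_ : k.+1%:R^-1 <= _); last first.
  by rewrite lef_pV2 ?posrE ?ltr0n// ler_nat.
apply: le_trans h; rewrite le_eqVlt; apply/orP; left; apply/eqP.
by rewrite /integ mulr_sumr; apply: eq_bigr => p _; rewrite mulrCA mulrBr.
Qed.

Lemma stage_inv2 i k u M x x' : 0 < M -> (forall y, `|u y| <= M) ->
  (i <= k)%N -> x \in products (known i) (depth i) ->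
  x' \in products (known i) (depth i) ->
  integ (stage k) (fun t => u (x * t)%g - u (x' * t)%g) <= 2 * M * i.+1%:R^-1.
Proof.
move=> M0 uM ik xi xi'; have NuM y : `|- u y| <= M by rewrite normrN.
have := lerD (stage_inv M0 NuM ik xi) (stage_inv M0 uM ik xi').
rewrite -big_split/= => h.
rewrite -mulrA mulr_natl mulr2n; apply: le_trans h.
rewrite le_eqVlt; apply/orP; left; apply/eqP; apply: eq_bigr => p _; lra.
Qed.

Variable pi : probability (discrete S) R.
Hypothesis piE : forall A : set (discrete S), pi A =
  (\sum_(k <oo) (2^-1 ^+ k.+1)%:E * (integ (stage k) (fun t => (t \in A)%:R))%:E)%E.

Let stage_prob k : finite_prob (stage k) := almost_inv_prob _ _.

Section Oscillation.
Variables (u : S -> R) (M : R).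
Hypotheses (M0 : 0 < M) (uM : forall x, `|u x| <= M) (hu : real_harmonic pi u).

(** One step of the random walk of law [pi]. With probability [1 - 2^-i] the
    increment comes from a stage before [i], hence lies in [known i], and the
    walk stays within products of elements of [known i]; otherwise it comes from
    a later stage, almost invariant under these products, so that the starting
    point is nearly forgotten. *)
Lemma harmonic_osc_step i m d : (m < depth i)%N ->
  (forall x x', x \in products (known i) m.+1 -> x' \in products (known i) m.+1 ->
    u x - u x' <= d) ->
  forall x x', x \in products (known i) m -> x' \in products (known i) m ->
    u x - u x' <= (1 - 2^-1 ^+ i) * d + 2^-1 ^+ i * (2 * M * i.+1%:R^-1).
Proof.
move=> mi osc_d x x' xm xm'; set e := 2 * M * i.+1%:R^-1.
have e0 : 0 <= e by rewrite !mulr_ge0 ?invr_ge0// ltW.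
have products_sub z : z \in products (known i) m ->
    z \in products (known i) (depth i).
  by apply: products_mono => //; [exact: known1|exact: ltnW].
pose D k := integ (stage k) (fun t => u (x * t)%g - u (x' * t)%g).
have D_near k : (i <= k)%N -> D k <= e.
  by move=> ik; apply: stage_inv2 => //; exact: products_sub.
have D_far k : (k < i)%N -> D k <= d.
  move=> ki; rewrite -[d]mul1r -(stage_prob k).2 -integ_cst /D /integ.
  rewrite big_seq [leRHS]big_seq; apply: ler_sum => p pk.
  rewrite ler_wpM2l ?(allP (stage_prob k).1)//.
  by apply: osc_d; apply: mem_products_mul => //; exact: stage_known pk.
have sum_le n : \sum_(k < i + n) 2^-1 ^+ k.+1 * D k <=
    (1 - 2^-1 ^+ i) * d + (2^-1 ^+ i - 2^-1 ^+ (i + n)) * e.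
  elim: n => [|n IH].
    rewrite addn0 subrr mul0r addr0 -sum_half mulr_suml; apply: ler_sum => k _.
    by rewrite ler_wpM2l ?half_ge0 ?D_far.
  rewrite addnS big_ord_recr/=; apply: le_trans (lerD IH (_ : _ <=
    2^-1 ^+ (i + n).+1 * e)) _.
    by rewrite ler_wpM2l ?half_ge0// D_near// leq_addr.
  by rewrite [2^-1 ^+ (i + n).+1]exprS; lra.
(* The mean value property holds for the first [i + n] components of [pi] up to
   [M * 2^-(i + n)]; the slack [c] absorbs twice this error. *)
apply/ler_addgt0Pr => c c0.
have [n nc] : exists n, 2 * M * 2^-1 ^+ (i + n) <= c.
  have M2 : 0 < c / (2 * M) by rewrite divr_gt0// mulr_gt0.
  have := @cvg_geometric R 1 2^-1 _.
  rewrite ger0_norm// invf_lt1// ltr1n => /(_ isT) /cvgr0Pnorm_lt /(_ _ M2)[n _ h].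
  exists n; have := h (i + n)%N (leq_addl _ _).
  rewrite /= mul1r ger0_norm ?half_ge0// => /ltW.
  by rewrite ler_pdivlMr ?mulr_gt0// mulrC.
have approx z := mixture_approx stage_prob piE (i + n) (fun t => uM (z * t)%g) (hu z).
have DE : \sum_(k < i + n) 2^-1 ^+ k.+1 * D k =
    \sum_(k < i + n) 2^-1 ^+ k.+1 * integ (stage k) (fun t => u (x * t)%g) -
    \sum_(k < i + n) 2^-1 ^+ k.+1 * integ (stage k) (fun t => u (x' * t)%g).
  by rewrite -sumrB; apply: eq_bigr => k _; rewrite -mulrBr -integB.
have := sum_le n; rewrite DE.
have := mulr_ge0 (half_ge0 R (i + n)) e0.
have := approx x; have := approx x'; rewrite !ler_norml; lra.
Qed.

Lemma harmonic_osc i j m : (m + j = depth i)%N ->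
  forall x x', x \in products (known i) m -> x' \in products (known i) m ->
    u x - u x' <= 2 * M * (1 - 2^-1 ^+ i) ^+ j + 2 * M * i.+1%:R^-1.
Proof.
elim: j m => [|j IH] m mj x x' xm xm'.
  have e0 : 0 <= 2 * M * i.+1%:R^-1 by rewrite !mulr_ge0 ?invr_ge0// ltW.
  set e := 2 * M * _ in e0 *.
  by have := uM x; have := uM x'; rewrite !ler_norml expr0; lra.
have mi : (m < depth i)%N by rewrite -mj addnS ltnS leq_addr.
have := harmonic_osc_step mi (IH m.+1 _) xm xm'.
rewrite addSnnS => /(_ mj); rewrite exprS; set e := 2 * M * i.+1%:R^-1; lra.
Qed.

(** The first alternative persists during [depth i] steps with probability at
    most [1 / (i + 1)]. *)
Lemma harmonic_osc_known i x x' : x \in known i -> x' \in known i ->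
  u x - u x' <= 4 * M * i.+1%:R^-1.
Proof.
move=> xi xi'; have := harmonic_osc (add0n (depth i)) xi xi'.
have : (1 - 2^-1 ^+ i) ^+ depth i <= i.+1%:R^-1 :> R.
  have h1 : 2^-1 ^+ i <= 1 :> R by rewrite exprn_ile1// invf_le1// ler1n.
  rewrite -[leRHS]mul1r ler_pdivlMr ?ltr0n//.
  have := bernoulli_inv (depth i) (half_ge0 R i) h1.
  rewrite /depth natrM natrX exprVn -mulrA divff ?mulr1 ?expf_neq0//.
  by rewrite nat1r.
have M2 : 0 < 2 * M by rewrite mulr_gt0.
move=> h; have := ler_wpM2l (ltW M2) h; set r := i.+1%:R^-1; lra.
Qed.

Lemma bounded_harmonic_const x : u x = u 1%g.
Proof.
have le x1 x2 : u x1 <= u x2.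
  apply/ler_addgt0Pr => e e0; rewrite -lerBlDl.
  have [[n1 <-] [n2 <-]] := (elt_surj x1, elt_surj x2).
  have M4 : 0 < e / (4 * M) by rewrite divr_gt0// mulr_gt0.
  have := @cvg_harmonic R; move=> /cvgr0Pnorm_lt /(_ _ M4)[n _ h].
  pose i := maxn n (maxn n1 n2).+1.
  have := h i (leq_maxl _ _); rewrite /= ger0_norm ?invr_ge0// => /ltW.
  rewrite ler_pdivlMr ?mulr_gt0// mulrC => /(le_trans _); apply.
  apply: harmonic_osc_known; apply: elt_known.
    by rewrite /i leq_max ltnS leq_maxl orbT.
  by rewrite /i leq_max ltnS leq_maxr orbT.
by apply/le_anti; rewrite !le.
Qed.

End Oscillation.
End KaimanovichVershik.

(** The mixture [\sum_k 2^-(k+1) theta_k] of increasingly invariant measures has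
    only constant bounded harmonic functions. *)
Lemma finite_reiter_liouville (R : realType) (S : monoidType) :
  countable [set: S] -> finite_reiter R S -> liouville R S.
Proof.
move=> /countable_injP[f finj] FR.
have /choice[elt eltP] n : exists x, forall y, f y = n -> x = y.
  have [[x fx]|nx] := pselect (exists x, f x = n).
    by exists x => y fy; apply: finj; rewrite ?inE// fx.
  by exists 1%g => y fy; exfalso; apply: nx; exists y.
have elt_surj x : exists n, elt n = x by exists (f x); exact: eltP.
have /choice[theta thetaP] (Kk : seq S * nat) : exists l, finite_prob l /\
    forall s b, s \in Kk.1 -> (forall x, `|b x| <= 1) ->
      integ l (fun t => b t - b (s * t)%g) <= Kk.2.+1%:R^-1 :> R.
  have k0 : 0 < Kk.2.+1%:R^-1 :> R by rewrite invr_gt0.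
  by have [l lp lK] := FR Kk.1 _ k0; exists l.
pose almost_inv K k := theta (K, k).
have almost_inv_prob K k : finite_prob (almost_inv K k) := (thetaP (K, k)).1.
have almost_inv_le K k := (thetaP (K, k)).2.
have /choice[P PE] k : exists P : probability (discrete S) R,
    forall A : set (discrete S),
      P A = (integ (stage elt almost_inv k) (fun t => (t \in A)%:R))%:E.
  by apply: finite_prob_measure; exact: almost_inv_prob.
have [pi piP] := mixture_measure P.
have piE A : pi A = (\sum_(k <oo) (2^-1 ^+ k.+1)%:E *
    (integ (stage elt almost_inv k) (fun t => (t \in A)%:R))%:E)%E.
  by rewrite piP; apply: eq_eseriesr => k _; rewrite PE.
exists pi; apply/real_liouville => u [M uM] hu x.
have M1 : 0 < M + 1 by rewrite ltr_wpDl// (le_trans _ (uM 1%g)).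
apply: (bounded_harmonic_const elt_surj almost_inv_prob almost_inv_le piE M1) => //.
by move=> y; apply: le_trans (uM y) _; rewrite lerDl.
Qed.

Theorem theorem6p10 (R : realType) (S : monoidType)
    (S_countable : countable [set: S]%classic) :
  (liouville R S <-> reiter R S) /\ (reiter R S <-> amenable R S).
Proof.
have FR_reiter := @finite_reiter_reiter R S S_countable.
have reiter_FR := @reiter_finite_reiter R S S_countable.
have FR_liouville := @finite_reiter_liouville R S S_countable.
have liouville_amenable : liouville R S -> amenable R S.
  move=> [pi /real_liouville pi_const]; apply: invariant_mean_amenable.
  exact: liouville_invariant_mean pi_const.
have amenable_FR : amenable R S -> finite_reiter R S.
  by move=> /amenable_invariant_mean; exact: invariant_mean_finite_reiter.
split; split.
- by move=> /liouville_amenable/amenable_FR.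
- by move=> /reiter_FR.
- by move=> /reiter_FR/FR_liouville.
- by move=> /amenable_FR.
Qed.
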